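(* Let $\lambda\in\mathbb{C}$ with $|\lambda|<1$ and let $\phi$ be an entire function of exponential type with $\phi(0)\neq 0$. Then the operator $L=R_\lambda\phi(D)$ on $\mathcal{H}(\mathbb{C})$ is not supercyclic.
   Context: $\mathcal{H}(\mathbb{C})$ is the Fréchet space of entire functions on $\mathbb{C}$ with the compact-open topology; $Df=f'$; $R_\lambda f(z)=f(\lambda z)$. An entire function $\phi(z)=\sum_k \phi_k z^k$ is of exponential type if there are constants $A,B$ with $|\phi(z)|\leq Ae^{B|z|}$ for all $z\in\mathbb{C}$; then $\phi(D)f=\sum_k\phi_k f^{(k)}$ is a continuous linear operator on $\mathcal{H}(\mathbb{C})$. A continuous linear operator $T$ is supercyclic if there is a vector $f$ such that $\{\mu T^nf: n\in\mathbb{N},\ \mu\in\mathbb{C}\}$ is dense. *)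

(* Defs.v *)
From HB Require Import structures.
From mathcomp Require Import all_boot all_order all_algebra.
From mathcomp Require Import complex.
From mathcomp Require Import all_classical all_reals all_analysis.

Set Implicit Arguments.
Unset Strict Implicit.
Unset Printing Implicit Defensive.

Import Order.TTheory GRing.Theory Num.Theory.
Import numFieldNormedType.Exports.

Local Open Scope classical_set_scope.
Local Open Scope ring_scope.

Definition supercyclic (K : numDomainType) (X : preTopologicalLmodType K)
    (T : X -> X) :=
  exists f : X, dense [set mu *: iter n T f | mu in [set: K] & n in [set: nat]].

(* R[i] seen as a numClosedFieldType: the norm topology of a numeric field is
   attached to the projection Num.ClosedField.sort and not to R[i] itself. *)
Notation Cplx R :=
  (Num.ClosedField.sort (complex_complex__canonical__Num_ClosedField R)).

Section EntireFunctions.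
Variable R : realType.
Local Notation C := (Cplx R).

Definition entire : {pred C -> C} :=
  mem [set f : C -> C | forall z : C, derivable f z 1].

Lemma entireP (f : C -> C) : reflect (forall z : C, derivable f z 1) (f \in entire).
Proof. exact: asboolP. Qed.

Lemma entire_submod_closed : submod_closed entire.
Proof.
split=> [|a f g /entireP df /entireP dg]; apply/entireP => z.
  exact: derivable_cst.
by apply: derivableD => //; exact: derivableZ.
Qed.

HB.instance Definition _ :=
  GRing.isSubmodClosed.Build C (C -> C) entire entire_submod_closed.

(* The space H(C), with the topology induced by the compact-open topology. *)
Definition entire_fun : Type := {f : C -> C | f \in entire}.

HB.instance Definition _ := [isSub of entire_fun for @sval _ _].
HB.instance Definition _ := [Choice of entire_fun by <:].
HB.instance Definition _ := [SubChoice_isSubLmodule of entire_fun by <:].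
HB.instance Definition _ := Topological.copy entire_fun
  (initial_topology (\val : entire_fun -> {compact-open, C -> C})).

Definition exponential_type (phi : entire_fun) :=
  exists A B : R, forall z : C,
    `|\val phi z| <= ((A * expR (B * complex.Re `|z|))%:C)%C.

Definition taylor_coef (phi : entire_fun) (k : nat) : C :=
  derive1n k (\val phi) 0 / k`!%:R.

(* The series converges and its sum is entire in z as soon as phi is of
   exponential type; the default value 0 only makes the operator total. *)
Definition diff_op (phi f : entire_fun) : entire_fun :=
  insubd (0 : entire_fun) (fun z : C =>
    limn (series (fun k => taylor_coef phi k * derive1n k (\val f) z))).

Lemma dilation_entire (lambda : C) (f : entire_fun) :
  (fun z => \val f (lambda * z)) \in entire.
Proof.
apply/entireP => z; apply/derivable1_diffP.
apply: (@differentiable_comp _ _ _ _ ( *%R lambda) (\val f)).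
  by apply/derivable1_diffP; apply: derivableM.
by apply/derivable1_diffP; apply/entireP; exact: valP.
Qed.

Definition dilation (lambda : C) (f : entire_fun) : entire_fun :=
  Sub (fun z => \val f (lambda * z)) (dilation_entire lambda f).

End EntireFunctions.

(* Main.v *)
Require Import Defs.
From mathcomp Require Import all_boot all_order all_algebra.
From mathcomp Require Import complex ring lra.
From mathcomp Require Import all_classical all_reals all_analysis.

Set Implicit Arguments.
Unset Strict Implicit.
Unset Printing Implicit Defensive.

Import Order.TTheory GRing.Theory Num.Theory.
Import numFieldNormedType.Exports.

Local Open Scope classical_set_scope.
Local Open Scope ring_scope.

(** Write phi(z) = sum p_k z^k. A sequence G with |G_n| n! <= K M^n defines
    the functional [pairing G] : f |-> sum G_n f^(n)(0), which is continuous
    for uniform convergence on one square. On the exponential z |-> e^(az) it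
    takes the value G(a) = sum G_n a^n, and the operator sends that exponential
    to phi(a) e^(lambda a z). Hence [pairing G] is an eigenfunctional for the
    eigenvalue mu as soon as phi(a) G(lambda a) = mu G(a) ([pairing_eigen]).
    For |lambda| < 1 the product F(a) = prod_k phi(lambda^k a)/phi(0) solves
    this equation with mu = phi(0) ([eigenweight_exists]), and a F(a) solves
    it with mu = lambda phi(0) ([eigenweight_shift]).

    Two such functionals forbid supercyclicity ([not_supercyclic]). Let PF
    and PG be the functionals of F(a) and a F(a). At mu L^n f both are
    multiplied by mu phi(0)^n, and PG also by lambda^n, so that
    |PG(g)| |PF(f)| <= |PF(g)| |PG(f)| for every g in the projective orbit of
    f, hence for every entire g if that orbit is dense. An affine g with
    PF(g) = 0 and PG(g) <> 0 gives PF(f) = 0; then PF vanishes on the orbit,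
    hence everywhere, although PF(1) = F_0 = 1.

    All this needs an entire function, that is, a function which is merely
    complex differentiable at every point, to be the sum of its Taylor series,
    with Cauchy estimates ([holo_pseries], [cauchy_estimate]). This follows
    the classical path: Goursat's theorem for rectangles by bisection
    ([goursat]), the same with one exceptional point ([goursat_punctured]),
    Cauchy's formula on a square centred at 0 ([cauchy_formula]) and the
    expansion of its kernel in a geometric series ([cauchy_expansion]). With
    squares instead of circles, integrals run along horizontal and vertical
    lines only, and the contour integral of 1/z enters through its being
    nonzero ([square_int_inv]). The integral of a continuous
    function is the increment of a primitive, so that additivity, linearity
    and bounds are statements about derivatives.

    The action of phi(D) on Taylor coefficients is an exchange of double sums
    ([csum_diag]); it is justified by geometric bounds ([diff_op_term_bound]),
    which hold because p_k = O(B^k/k!) for phi of exponential type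
    ([exponential_coef]) while the coefficients of f decay faster than any
    geometric sequence. *)

(** * The complex plane with its real-valued modulus *)
Section Cplx.
Variable R : realType.
Local Notation C := (Cplx R).
Implicit Types (x y : R) (z w : C).

(** The norm of a complex number is itself complex; the real-valued modulus
    makes estimates accessible to linear arithmetic over the reals. *)
Definition nrm z : R := complex.Re `|z|.
Definition ofR x : C := (x%:C)%C.
Definition cre z : R := complex.Re z.
Definition cim z : R := complex.Im z.
Definition I_ : C := ('i)%C.

Lemma nrmE z : `|z| = ofR (nrm z).
Proof.
by rewrite /nrm /ofR (RRe_real (normr_real z)).
Qed.

Lemma ofRD x y : ofR (x + y) = ofR x + ofR y.
Proof. exact: (rmorphD (real_complex R)). Qed.
Lemma ofRM x y : ofR (x * y) = ofR x * ofR y.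
Proof. exact: (rmorphM (real_complex R)). Qed.
Lemma ofRN x : ofR (- x) = - ofR x.
Proof. exact: (rmorphN (real_complex R)). Qed.
Lemma ofR1 : ofR 1 = 1. Proof. by []. Qed.
Lemma ofR0 : ofR 0 = 0. Proof. by []. Qed.
Lemma ofR_lt x y : (ofR x < ofR y) = (x < y).
Proof. exact: ltcR. Qed.
Lemma ofR_le x y : (ofR x <= ofR y) = (x <= y).
Proof. exact: lecR. Qed.
Lemma ofR_inj : injective ofR. Proof. exact: complexI. Qed.
Lemma creD z w : cre (z + w) = cre z + cre w.
Proof. by case: z; case: w. Qed.
Lemma cimD z w : cim (z + w) = cim z + cim w.
Proof. by case: z; case: w. Qed.
Lemma creM z w : cre (z * w) = cre z * cre w - cim z * cim w.
Proof. by case: z; case: w. Qed.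
Lemma cimM z w : cim (z * w) = cre z * cim w + cim z * cre w.
Proof. by case: z => a b; case: w => c d; rewrite /= addrC. Qed.
Lemma cre_ofR x : cre (ofR x) = x. Proof. by []. Qed.
Lemma cim_ofR x : cim (ofR x) = 0. Proof. by []. Qed.
Lemma creN z : cre (- z) = - cre z. Proof. by case: z. Qed.
Lemma cimN z : cim (- z) = - cim z. Proof. by case: z. Qed.
Lemma cre_I : cre I_ = 0. Proof. by []. Qed.
Lemma cim_I : cim I_ = 1. Proof. by []. Qed.
Lemma I_sqr : I_ * I_ = -1.
Proof. rewrite -expr2; exact: sqr_i. Qed.
Lemma creim_eta z : z = ofR (cre z) + I_ * ofR (cim z).
Proof. exact: complexE. Qed.
Lemma c_eq z w : cre z = cre w -> cim z = cim w -> z = w.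
Proof. by move=> h1 h2; rewrite (creim_eta z) (creim_eta w) h1 h2. Qed.

Lemma nrmM z w : nrm (z * w) = nrm z * nrm w.
Proof. by apply: ofR_inj; rewrite ofRM -!nrmE normrM. Qed.
Lemma nrmD z w : nrm (z + w) <= nrm z + nrm w.
Proof. by rewrite -ofR_le ofRD -!nrmE ler_normD. Qed.
Lemma nrm0 : nrm 0 = 0.
Proof. by apply: ofR_inj; rewrite -nrmE normr0. Qed.
Lemma nrm1 : nrm 1 = 1.
Proof. by apply: ofR_inj; rewrite -nrmE normr1. Qed.
Lemma nrm_ge0 z : 0 <= nrm z.
Proof. by rewrite -ofR_le -nrmE normr_ge0. Qed.
Lemma nrm_eq0 z : (nrm z == 0) = (z == 0).
Proof. by rewrite -[RHS]normr_eq0 nrmE -ofR0 (inj_eq ofR_inj). Qed.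
Lemma nrm_gt0 z : (0 < nrm z) = (z != 0).
Proof. by rewrite -ofR_lt -nrmE normr_gt0. Qed.
Lemma nrmN z : nrm (- z) = nrm z.
Proof. by apply: ofR_inj; rewrite -!nrmE normrN. Qed.
Lemma nrmB z w : nrm (z - w) = nrm (w - z).
Proof. by rewrite -nrmN opprB. Qed.
Lemma nrmX z n : nrm (z ^+ n) = nrm z ^+ n.
Proof. by elim: n => [|n IH]; rewrite ?expr0 ?nrm1// !exprS nrmM IH. Qed.
Lemma nrmV z : nrm z^-1 = (nrm z)^-1.
Proof.
have [->|z0] := eqVneq z 0; first by rewrite !(invr0, nrm0).
by apply: (mulIf (x := nrm z)); rewrite ?nrm_eq0// -nrmM !mulVf ?nrm1 ?nrm_eq0.
Qed.
Lemma nrm_ofR x : nrm (ofR x) = `|x|.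
Proof.
rewrite /nrm /ofR normc_def/= expr0n/= addr0; exact: sqrtr_sqr.
Qed.
Lemma nrm_nat n : nrm n%:R = n%:R.
Proof.
apply: ofR_inj; rewrite -nrmE normr_nat; symmetry.
exact: (rmorph_nat (real_complex R)).
Qed.
Lemma ofR_nat n : ofR n%:R = n%:R.
Proof. exact: (rmorph_nat (real_complex R)). Qed.
Lemma nrm_I : nrm I_ = 1.
Proof. by rewrite /nrm normc_def/= expr0n expr1n/= add0r sqrtr1. Qed.
Lemma cre_le z : `|cre z| <= nrm z.
Proof. rewrite -ofR_le -nrmE; exact: normc_ge_Re. Qed.
Lemma cim_le z : `|cim z| <= nrm z.
Proof.
have := cre_le (- I_ * z); rewrite nrmM nrmN nrm_I mul1r.
by rewrite creM creN cimN cre_I cim_I oppr0 mul0r sub0r mulN1r opprK.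
Qed.
Lemma nrm_reim z : nrm z <= `|cre z| + `|cim z|.
Proof.
by rewrite {1}(creim_eta z) (le_trans (nrmD _ _))// nrmM nrm_I mul1r !nrm_ofR.
Qed.
Lemma nrm_sum (T : Type) (r : seq T) (P : pred T) (F : T -> C) :
  nrm (\sum_(i <- r | P i) F i) <= \sum_(i <- r | P i) nrm (F i).
Proof.
elim/big_ind2: _ => //; first by rewrite nrm0.
move=> x1 x2 y1 y2 h1 h2; exact: le_trans (nrmD _ _) (lerD h1 h2).
Qed.

Lemma cpos (e : C) : 0 < e -> exists2 x, 0 < x & e = ofR x.
Proof.
move=> e0; exists (cre e).
  rewrite -ofR_lt; have := e0; rewrite {1}(_ : e = ofR (cre e)) //.
  exact/esym/RRe_real/gtr0_real.
by apply/esym/RRe_real/gtr0_real.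
Qed.

Lemma near_nrmP (P : set C) z :
  (\forall w \near z, P w) <-> exists2 d, 0 < d & forall w, nrm (w - z) < d -> P w.
Proof.
split.
  move=> /nbhs_ballP[e /= /cpos[d d0 ->] h]; exists d => // w wd; apply: h.
  by rewrite -ball_normE /ball_/= nrmE ofR_lt nrmB.
move=> [d d0 h]; apply/nbhs_ballP; exists (ofR d) => /=; first by rewrite -ofR0 ofR_lt.
by move=> w; rewrite -ball_normE /ball_/= nrmE ofR_lt nrmB => /h.
Qed.

Lemma cvg_nrmP (T : Type) (F : set_system T) {FF : Filter F} (f : T -> C) (l : C) :
  (f x @[x --> F] --> l) <-> (forall e, 0 < e -> \forall x \near F, nrm (f x - l) < e).
Proof.
split.
  move=> /cvgrPdist_lt h e e0; have := h (ofR e).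
  rewrite -ofR0 ofR_lt => /(_ e0); apply: filterS => x.
  by rewrite nrmE ofR_lt nrmB.
move=> h; apply/cvgrPdist_lt => e /cpos[d d0 ->].
by apply: filterS (h d d0) => x; rewrite nrmE ofR_lt nrmB.
Qed.

(** The first-order expansion f (z + h) = f z + h d + o(h), in the form without
    quotients that is used inside integrals. *)
Definition cderive (f : C -> C) z d :=
  forall e, 0 < e -> exists2 del, 0 < del &
    forall h, nrm h < del -> nrm (f (z + h) - f z - h * d) <= e * nrm h.

Lemma cderiveP (f : C -> C) z d :
  (h^-1 *: (f (h + z) - f z)) @[h --> (0:C)^'] --> d <-> cderive f z d.
Proof.
rewrite cvg_nrmP; split.
  move=> H e e0; have /near_nrmP[del del0 {}H] := H e e0; exists del => // h hdel.
  have [->|h0] := eqVneq h 0.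
    by rewrite addr0 subrr mul0r subr0 nrm0 mulr0.
  have := H h; rewrite subr0 => /(_ hdel h0).
  rewrite [h + z]addrC.
  have -> : f (z + h) - f z - h * d = h * (h^-1 *: (f (z + h) - f z) - d).
    by rewrite mulrBr mulrA mulfV// mul1r.
  by move=> /ltW H2; rewrite nrmM mulrC; apply: ler_wpM2r H2; exact: nrm_ge0.
move=> H e e0; have [|del del0 {}H] := H (e / 2) _; first by rewrite divr_gt0.
apply/near_nrmP; exists del => // h; rewrite subr0 => /H {}H h0.
rewrite -(ltr_pM2l (x := nrm h)) ?nrm_gt0// -nrmM mulrBr mulrA mulfV// mul1r.
rewrite [h + z]addrC; apply: le_lt_trans H _.
by rewrite mulrC ltr_pM2l ?nrm_gt0//; lra.
Qed.

Lemma derivable_cderiveP (f : C -> C) z :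
  derivable f z 1 <-> exists d, cderive f z d.
Proof.
have E : (fun h : C => h^-1 *: ((f \o shift z) (h *: (1 : C)) - f z))
  = (fun h : C => h^-1 *: (f (h + z) - f z)).
  by apply/funext => h /=; rewrite /GRing.scale/= mulr1.
rewrite /derivable E; split.
  by move=> /cvg_ex[d /cderiveP]; exists d.
by move=> [d /cderiveP h]; apply/cvg_ex; exists d.
Qed.

Lemma cderive_derive1 (f : C -> C) z d : cderive f z d -> derive1 f z = d.
Proof. by move/cderiveP => H; apply/cvg_lim. Qed.

Lemma derivable_cderive (f : C -> C) z : derivable f z 1 -> cderive f z (derive1 f z).
Proof. by move=> /derivable_cderiveP[d df]; rewrite (cderive_derive1 df). Qed.

End Cplx.

(** * Integrals of continuous real functions as increments of primitives *)
Section RealInt.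
Variable R : realType.
Implicit Types (x y a b : R) (g G : R -> R).

Lemma rderiveP G x d :
  (forall e, 0 < e -> exists2 del, 0 < del &
    forall h, `|h| < del -> `|G (x + h) - G x - h * d| <= e * `|h|) ->
  is_derive x 1 G d.
Proof.
move=> H.
have L : (h^-1 *: (G (h + x) - G x)) @[h --> (0:R)^'] --> d.
  apply/cvgrPdist_le => e e0; have [del del0 {}H] := H e e0.
  apply/nbhs_ballP; exists del => // h; rewrite -ball_normE /ball_/= sub0r normrN.
  move=> /H {}H h0; rewrite distrC -(ler_pM2l (x := `|h|)) ?normr_gt0// -normrM.
  have -> : h * (h^-1 *: (G (h + x) - G x) - d) = G (x + h) - G x - h * d.
    by rewrite mulrBr /GRing.scale/= mulrA mulfV// mul1r [h + x]addrC.
  by rewrite [leRHS]mulrC.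
have E : (fun h : R => h^-1 *: ((G \o shift x) (h *: (1 : R)) - G x))
  = (fun h : R => h^-1 *: (G (h + x) - G x)).
  by apply/funext => h /=; rewrite /GRing.scale/= mulr1.
apply: DeriveDef; first by rewrite /derivable E; apply/cvg_ex; exists d.
by rewrite /derive E; apply/cvg_lim.
Qed.

Lemma is_derive_cont G g : (forall x, is_derive x 1 G (g x)) -> continuous G.
Proof.
move=> H x; apply: differentiable_continuous; apply/derivable1_diffP.
by case: (H x).
Qed.

Lemma incr_bound G g a b m M : a <= b -> (forall x, is_derive x 1 G (g x)) ->
  (forall x, a <= x <= b -> m <= g x <= M) ->
  m * (b - a) <= G b - G a <= M * (b - a).
Proof.
move=> ab H gM.
have cG : {within `[a, b], continuous G}.
  by apply: continuous_subspaceT; exact: is_derive_cont H.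
have [c + ->] := MVT_segment ab (fun x _ => H x) cG.
rewrite in_itv/= => /gM /andP[h1 h2].
by rewrite !ler_wpM2r// subr_ge0.
Qed.

(** Stated on an open interval because global primitives are glued from
    primitives that exist on bounded intervals only. *)
Lemma prim_unique (G1 G2 : R -> R) g a b :
  (forall x, a < x < b -> is_derive x 1 G1 (g x)) ->
  (forall x, a < x < b -> is_derive x 1 G2 (g x)) ->
  forall x y, a < x < b -> a < y < b -> G1 x - G1 y = G2 x - G2 y.
Proof.
move=> H1 H2.
have aux x y : a < x < b -> a < y < b -> x <= y -> G1 x - G1 y = G2 x - G2 y.
  move=> /andP[ax xb] /andP[ay yb] xy.
  have D t : x <= t <= y -> is_derive t 1 (G1 - G2) (g t - g t).
    move=> /andP[xt ty]; have tab : a < t < b.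
      by rewrite (lt_le_trans ax xt) (le_lt_trans ty yb).
    by apply: is_deriveB; [exact: H1|exact: H2].
  have D' t : t \in `]x, y[%R -> is_derive t 1 (G1 - G2) (g t - g t).
    by rewrite in_itv/= => /andP[/ltW xt /ltW ty]; apply: D; rewrite xt ty.
  have cG : {within `[x, y], continuous (G1 - G2)}.
    apply: derivable_within_continuous => t; rewrite in_itv/= => h.
    by case: (D t h).
  have [c _] := MVT_segment xy D' cG.
  rewrite subrr mul0r !fctE => h.
  by lra.
move=> x y hx hy; case: (leP x y) => [|/ltW] xy; first exact: aux.
by apply: oppr_inj; rewrite !opprB; exact: aux.
Qed.

Lemma prim_exists_itv g (M : R) : continuous g ->
  exists G, forall x, - M < x < M -> is_derive x 1 G (g x).
Proof.
move=> cg.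
exists (fun x => (\int[lebesgue_measure]_(t in [set` `[(- M), x]]) (g t))%R) => x /andP[Mx xM].
have [] := @continuous_FTC1_closed R g (- M) x M xM _ Mx (cg x).
  apply: continuous_compact_integrable; first exact: segment_compact.
  exact: continuous_subspaceT.
by rewrite derive1E => h1 h2; exact: DeriveDef.
Qed.

(** Normalised to vanish at 0, the primitives on the intervals ]-n, n[ agree
    where they overlap, so each point may use any interval that contains it. *)
Lemma prim_exists g : continuous g -> exists G, forall x, is_derive x 1 G (g x).
Proof.
move=> cg.
have [P HP] := choice (fun n : nat => @prim_exists_itv g n.+1%:R cg).
pose n x := (Num.truncn `|x|).+1.
have nP x : `|x| < (n x)%:R by have := truncnS_gt `|x|.
exists (fun x => P (n x) x - P (n x) 0) => x.
have eqP m k y : `|y| < m.+1%:R -> `|y| < k.+1%:R -> P m y - P m 0 = P k y - P k 0.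
  wlog mk : m k / (m <= k)%N.
    move=> H h1 h2; case: (leqP m k) => [|/ltnW] mk; first exact: H.
    by apply/esym/H.
  rewrite !ltr_norml => h1 h2.
  apply: (prim_unique (g := g) (a := - m.+1%:R) (b := m.+1%:R)) => //.
  - move=> t /andP[t1 t2]; apply: HP; apply/andP; split.
      by apply: le_lt_trans t1; rewrite lerN2 ler_nat ltnS.
    by apply: lt_le_trans t2 _; rewrite ler_nat ltnS.
  - by rewrite oppr_lt0 ltr0n.
have D : is_derive x 1 (fun y => P (n x) y - P (n x) 0) (g x).
  rewrite -[g x]subr0; apply: is_deriveB; apply: HP.
  by rewrite -ltr_norml (lt_le_trans (nP x))// ler_nat.
case: D => D1 D2.
have nearE : \forall y \near x, P (n x) y - P (n x) 0 = P (n y) y - P (n y) 0.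
  have [d d0 hd] : exists2 d, 0 < d & forall y, `|x - y| < d -> `|y| < (n x).+1%:R.
    exists 1 => // y xy; rewrite -natr1 (le_lt_trans _ (ltrD (nP x) xy))//.
    by rewrite addrC -[X in `|X| <= _](subKr x) (le_trans (ler_normB _ _))// addrC.
  apply/nbhs_ballP; exists d => // y; rewrite -ball_normE /ball_/= => /hd h.
  by apply: eqP => //; apply: lt_le_trans (nP y) _; rewrite ler_nat.
apply: DeriveDef; first exact: near_eq_derivable D1.
by rewrite -D2; apply/esym; apply: near_eq_derive.
Qed.

(** The bounds are not assumed to be ordered, and the value does not depend on
    the primitive; for a function without primitive the value is 0. *)
Definition rint g a b : R :=
  if pselect (exists G, forall x, is_derive x 1 G (g x)) is left h
  then projT1 (cid h) b - projT1 (cid h) a else 0.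

Lemma rintE G g a b : (forall x, is_derive x 1 G (g x)) -> rint g a b = G b - G a.
Proof.
move=> HG; rewrite /rint; case: pselect => [h|]; last by case; exists G.
case: (cid h) => F HF /=.
pose M := `|a| + `|b| + 1.
have aM : - M < a < M by rewrite -ltr_norml /M; have := normr_ge0 b; lra.
have bM : - M < b < M by rewrite -ltr_norml /M; have := normr_ge0 a; lra.
exact: (@prim_unique F G g (- M) M).
Qed.

Lemma rintD g1 g2 a b c : continuous g1 -> continuous g2 ->
  rint (fun x => c * g1 x + g2 x) a b = c * rint g1 a b + rint g2 a b.
Proof.
move=> /prim_exists[G1 H1] /prim_exists[G2 H2].
rewrite (rintE a b H1) (rintE a b H2).
rewrite (@rintE (fun x => c *: G1 x + G2 x)); first by rewrite /GRing.scale/=; ring.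
Qed.

Lemma rint_split g a b m : rint g a b = rint g a m + rint g m b.
Proof. by rewrite /rint; case: pselect => [h|h]; ring. Qed.

Lemma rint_bound g a b m M : a <= b -> continuous g ->
  (forall x, a <= x <= b -> m <= g x <= M) ->
  m * (b - a) <= rint g a b <= M * (b - a).
Proof.
by move=> ab /prim_exists[G H] gM; rewrite (rintE a b H); exact: incr_bound H gM.
Qed.

End RealInt.

(** * Contour integrals along rectangles *)
Section Rect.
Variable R : realType.
Local Notation C := (Cplx R).
Implicit Types (x y a b c d : R) (z w : C) (g : C -> C) (h : R -> C).

Definition cpoint x y : C := ofR x + I_ R * ofR y.

Lemma cre_cpoint x y : cre (cpoint x y) = x.
Proof. by rewrite creD creM cre_ofR cre_I cim_I !cim_ofR; ring. Qed.
Lemma cim_cpoint x y : cim (cpoint x y) = y.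
Proof. by rewrite cimD cimM cre_ofR cre_I cim_I cim_ofR; ring. Qed.
Lemma cpoint_eta z : cpoint (cre z) (cim z) = z. Proof. by rewrite /cpoint -creim_eta. Qed.

Lemma ofR_continuous : continuous (@ofR R).
Proof.
move=> x; apply/cvg_nrmP => e e0.
have : \forall y \near (x : R), `|x - y| < e.
  by move/cvgrPdist_lt : (@cvg_id _ (nbhs (x : R))) => /(_ e e0).
by apply: filterS => y; rewrite -nrm_ofR ofRD ofRN nrmB.
Qed.
Lemma lip1_continuous (p : C -> R) :
  (forall z w, `|p z - p w| <= nrm (w - z)) -> continuous p.
Proof.
move=> H z; have FF : Filter (nbhs (z : C)) by exact: nbhs_filter.
apply/(@cvgrPdist_lt _ _ _ (nbhs (z : C)) FF) => e e0; apply/near_nrmP; exists e => // w wz.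
exact: le_lt_trans (H z w) wz.
Qed.
Lemma cre_continuous : continuous (@cre R : C -> R).
Proof. by apply: lip1_continuous => z w; rewrite -creN -creD nrmB cre_le. Qed.
Lemma cim_continuous : continuous (@cim R : C -> R).
Proof. by apply: lip1_continuous => z w; rewrite -cimN -cimD nrmB cim_le. Qed.
Lemma nrm_continuous : continuous (@nrm R : C -> R).
Proof.
apply: lip1_continuous => z w; rewrite ler_norml.
have := nrmD (z - w) w; have := nrmD (w - z) z.
by rewrite !subrK (nrmB z w) => ? ?; apply/andP; split; lra.
Qed.

Lemma hline_continuous c : continuous (fun x : R => cpoint x c).
Proof.
by move=> t; apply: cvgD; [exact: ofR_continuous|exact: cvg_cst].
Qed.
Lemma vline_continuous c : continuous (fun x : R => cpoint c x).
Proof.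
move=> t; apply: cvgD; first exact: cvg_cst.
by apply: cvgM; [exact: cvg_cst|exact: ofR_continuous].
Qed.

Lemma cderive_continuous g z (d : C) : cderive g z d -> {for z, continuous g}.
Proof.
move=> dg; apply: differentiable_continuous; apply/derivable1_diffP.
by apply/derivable_cderiveP; exists d.
Qed.

Definition line_int h a b : C :=
  ofR (rint (fun t => cre (h t)) a b) + I_ R * ofR (rint (fun t => cim (h t)) a b).

Lemma cont_re h : continuous h -> continuous (fun t => cre (h t)).
Proof. by move=> ch x; apply: continuous_comp; [exact: ch|exact: cre_continuous]. Qed.
Lemma cont_im h : continuous h -> continuous (fun t => cim (h t)).
Proof. by move=> ch x; apply: continuous_comp; [exact: ch|exact: cim_continuous]. Qed.

Lemma line_int_lin k h1 h2 a b : continuous h1 -> continuous h2 ->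
  line_int (fun t => k * h1 t + h2 t) a b = k * line_int h1 a b + line_int h2 a b.
Proof.
move=> c1 c2; have [r1 i1 r2 i2] := And4 (cont_re c1) (cont_im c1) (cont_re c2) (cont_im c2).
have lin (u v : R -> R) (r s : R) (w : R -> R) : continuous u -> continuous v -> continuous w ->
    rint (fun t => r * u t + (s * v t + w t)) a b =
    r * rint u a b + (s * rint v a b + rint w a b).
  move=> cu cv cw; rewrite (rintD _ _ r cu) ?(rintD _ _ s cv)// => t.
  by apply: cvgD; [apply: cvgM; [exact: cvg_cst|exact: cv]|exact: cw].
rewrite /line_int.
have -> : (fun t => cre (k * h1 t + h2 t)) =
    (fun t => cre k * cre (h1 t) + (- cim k * cim (h1 t) + cre (h2 t))).
  by apply/funext => t; rewrite creD creM; ring.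
have -> : (fun t => cim (k * h1 t + h2 t)) =
    (fun t => cre k * cim (h1 t) + (cim k * cre (h1 t) + cim (h2 t))).
  by apply/funext => t; rewrite cimD cimM; ring.
rewrite !lin// !(ofRD, ofRM, ofRN) {5}(creim_eta k).
have := I_sqr R; move: (I_ R) => i ii.
set A := ofR _; set A1 := ofR _; set B := ofR _; set B1 := ofR _.
set A2 := ofR _; set B2 := ofR _.
transitivity (A * A1 + (i * i) * (B * B1) + A2 + i * (A * B1 + (B * A1 + B2))).
  by rewrite ii; ring.
by ring.
Qed.

Lemma line_int_scale k h a b : continuous h ->
  line_int (fun t => k * h t) a b = k * line_int h a b.
Proof.
move=> ch; have c0 : continuous (fun _ : R => 0 : C) by move=> ?; exact: cvg_cst.
have Z : line_int (fun _ => 0) a b = 0.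
  have Z1 (p : C -> R) : p 0 = 0 -> rint (fun _ => p 0) a b = 0.
    move=> ->; have D x : is_derive x 1 (fun _ : R => 0 : R) 0 by exact: is_derive_cst.
    by rewrite (rintE a b D) subrr.
  by rewrite /line_int !Z1// ofR0 mulr0 addr0.
have := @line_int_lin k h _ a b ch c0; rewrite Z addr0 => <-.
by congr line_int; apply/funext => t; rewrite addr0.
Qed.

Lemma line_int_split h a b m : line_int h a b = line_int h a m + line_int h m b.
Proof. by rewrite /line_int !(rint_split _ a b m) !ofRD; ring. Qed.

Lemma line_int_bound h a b M : a <= b -> continuous h ->
  (forall t, a <= t <= b -> nrm (h t) <= M) -> nrm (line_int h a b) <= 2 * M * (b - a).
Proof.
move=> ab ch hM.
have B (u : R -> R) : continuous u -> (forall t, a <= t <= b -> `|u t| <= M) ->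
    `|rint u a b| <= M * (b - a).
  move=> cu uM; rewrite ler_norml -mulNr; apply: rint_bound => // t /uM.
  by rewrite ler_norml.
rewrite /line_int (le_trans (nrmD _ _))// nrmM nrm_I mul1r !nrm_ofR.
have -> : 2 * M * (b - a) = M * (b - a) + M * (b - a) by ring.
apply: lerD; apply: B.
- exact: cont_re.
- by move=> t /hM; apply: le_trans; exact: cre_le.
- exact: cont_im.
- by move=> t /hM; apply: le_trans; exact: cim_le.
Qed.

(** The real functions re (Phi (z0 + t v)) and im (Phi (z0 + t v)) are
    primitives of the two components of the integrand, by the chain rule; both
    cases are treated at once through a real-linear contraction p. *)
Lemma line_int_prim (Phi : C -> C) (phi : R -> C) z0 v a b :
  (forall t, cderive Phi (z0 + ofR t * v) (phi t)) ->
  line_int (fun t => phi t * v) a b = Phi (z0 + ofR b * v) - Phi (z0 + ofR a * v).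
Proof.
move=> D.
have aux (p : C -> R) : (forall z w, p (z + w) = p z + p w) -> (forall z, p (- z) = - p z) ->
    (forall z, `|p z| <= nrm z) -> (forall (x : R) z, p (ofR x * z) = x * p z) ->
    rint (fun t => p (phi t * v)) a b = p (Phi (z0 + ofR b * v)) - p (Phi (z0 + ofR a * v)).
  move=> pD pN ple pR.
  apply: (@rintE _ (fun t => p (Phi (z0 + ofR t * v)))) => t.
  apply: rderiveP => e e0.
  have v1 : 0 < nrm v + 1 by have := nrm_ge0 v; lra.
  have [del del0 H] := D t (e / (nrm v + 1)) (divr_gt0 e0 v1).
  exists (del / (nrm v + 1)); first exact: divr_gt0.
  move=> h hdel.
  have E : z0 + ofR (t + h) * v = z0 + ofR t * v + ofR h * v by rewrite ofRD; ring.
  have hv : nrm (ofR h * v) <= `|h| * (nrm v + 1).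
    by rewrite nrmM nrm_ofR ler_wpM2l//; lra.
  rewrite E -pR -!pN -!pD (le_trans (ple _))//.
  have -> : ofR h * (phi t * v) = ofR h * v * phi t by ring.
  apply: le_trans (H _ _) _.
    by apply: le_lt_trans hv _; rewrite -ltr_pdivlMr.
  apply: le_trans (ler_wpM2l (ltW (divr_gt0 e0 v1)) hv) _.
  by rewrite mulrCA divfK ?lt0r_neq0// mulrC.
rewrite /line_int !aux.
- set Pb := Phi (z0 + ofR b * v); set Pa := Phi _.
  by rewrite {3}(creim_eta Pb) {3}(creim_eta Pa) !(ofRD, ofRN) mulrDr mulrN; ring.
- exact: cimD.
- exact: cimN.
- exact: cim_le.
- by move=> x z; rewrite cimM cre_ofR cim_ofR mul0r addr0.
- exact: creD.
- exact: creN.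
- exact: cre_le.
- by move=> x z; rewrite creM cre_ofR cim_ofR mul0r subr0.
Qed.

(** The contour integral along the boundary of [a, b] x [c, d], traversed
    counterclockwise; the factor I_ comes from dz = i dy on vertical sides. *)
Definition rect_int g a b c d : C :=
  line_int (fun x => g (cpoint x c)) a b - line_int (fun x => g (cpoint x d)) a b
  + I_ R * (line_int (fun y => g (cpoint b y)) c d - line_int (fun y => g (cpoint a y)) c d).

(** Continuity is asked along the whole lines that carry the sides, since a
    primitive is a function on all of R. *)
Definition edge_cont g a b c d := [/\ continuous (fun x => g (cpoint x c)),
  continuous (fun x => g (cpoint x d)), continuous (fun y => g (cpoint a y)) &
  continuous (fun y => g (cpoint b y))].

Lemma continuous_edge g a b c d : continuous g -> edge_cont g a b c d.
Proof.
move=> cg; split=> t; apply: continuous_comp; try exact: cg;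
  by [exact: hline_continuous|exact: vline_continuous].
Qed.

Lemma rect_int_lin k g1 g2 a b c d : edge_cont g1 a b c d -> edge_cont g2 a b c d ->
  rect_int (fun z => k * g1 z + g2 z) a b c d = k * rect_int g1 a b c d + rect_int g2 a b c d.
Proof. by move=> [? ? ? ?] [? ? ? ?]; rewrite /rect_int !line_int_lin//; ring. Qed.

Lemma rect_int_splitx g a b c d m :
  rect_int g a b c d = rect_int g a m c d + rect_int g m b c d.
Proof. rewrite /rect_int !(line_int_split _ a b m); ring. Qed.

Lemma rect_int_splity g a b c d m :
  rect_int g a b c d = rect_int g a b c m + rect_int g a b m d.
Proof. rewrite /rect_int !(line_int_split _ c d m); ring. Qed.

Definition on_edge a b c d z := (a <= cre z <= b /\ c <= cim z <= d) /\
  (cre z = a \/ cre z = b \/ cim z = c \/ cim z = d).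

Lemma rect_int_bound g a b c d M : a <= b -> c <= d -> edge_cont g a b c d ->
  (forall z, on_edge a b c d z -> nrm (g z) <= M) ->
  nrm (rect_int g a b c d) <= 4 * M * ((b - a) + (d - c)).
Proof.
move=> ab cd [c1 c2 c3 c4] gM.
have H1 := line_int_bound ab c1 (M := M); have H2 := line_int_bound ab c2 (M := M).
have H3 := line_int_bound cd c3 (M := M); have H4 := line_int_bound cd c4 (M := M).
rewrite /rect_int.
apply: le_trans (nrmD _ _) _; rewrite nrmM nrm_I mul1r.
have B1 := nrmD (line_int (fun x => g (cpoint x c)) a b)
  (- line_int (fun x => g (cpoint x d)) a b).
have B2 := nrmD (line_int (fun y => g (cpoint b y)) c d)
  (- line_int (fun y => g (cpoint a y)) c d).
rewrite !nrmN in B1 B2.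
have {}H1 := H1 _; have {}H2 := H2 _; have {}H3 := H3 _; have {}H4 := H4 _.
have E1 : forall t : R, a <= t <= b -> nrm (g (cpoint t c)) <= M.
  move=> t tab; apply: gM; rewrite /on_edge cre_cpoint cim_cpoint lexx cd tab.
  by split => //; right; right; left.
have E2 : forall t : R, a <= t <= b -> nrm (g (cpoint t d)) <= M.
  move=> t tab; apply: gM; rewrite /on_edge cre_cpoint cim_cpoint lexx cd tab.
  by split => //; right; right; right.
have E3 : forall t : R, c <= t <= d -> nrm (g (cpoint a t)) <= M.
  move=> t tab; apply: gM; rewrite /on_edge cre_cpoint cim_cpoint lexx ab tab.
  by split => //; left.
have E4 : forall t : R, c <= t <= d -> nrm (g (cpoint b t)) <= M.
  move=> t tab; apply: gM; rewrite /on_edge cre_cpoint cim_cpoint lexx ab tab.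
  by split => //; right; left.
move: (H1 E1) (H2 E2) (H3 E3) (H4 E4) B1 B2.
have -> : 4 * M * (b - a + (d - c)) = 2 * M * (b - a) + 2 * M * (b - a)
  + (2 * M * (d - c) + 2 * M * (d - c)) by ring.
lra.
Qed.

Lemma rect_int_prim (Phi phi : C -> C) a b c d : edge_cont phi a b c d ->
  (forall z, cre z = a \/ cre z = b \/ cim z = c \/ cim z = d -> cderive Phi z (phi z)) ->
  rect_int phi a b c d = 0.
Proof.
move=> [c1 c2 c3 c4] D.
have hz (y : R) : (forall x, cderive Phi (cpoint x y) (phi (cpoint x y))) ->
    line_int (fun x => phi (cpoint x y)) a b = Phi (cpoint b y) - Phi (cpoint a y).
  move=> Dy.
  have E (x : R) : I_ R * ofR y + ofR x * 1 = cpoint x y by rewrite /cpoint; ring.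
  have := @line_int_prim Phi (fun x => phi (cpoint x y)) (I_ R * ofR y) 1 a b.
  rewrite !E => <-; first by congr line_int; apply/funext => t; rewrite mulr1.
  by move=> t; rewrite E.
have vt (x : R) : continuous (fun y => phi (cpoint x y)) ->
   (forall y, cderive Phi (cpoint x y) (phi (cpoint x y))) ->
    I_ R * line_int (fun y => phi (cpoint x y)) c d = Phi (cpoint x d) - Phi (cpoint x c).
  move=> cx Dx; rewrite -line_int_scale//.
  have E (y : R) : ofR x + ofR y * I_ R = cpoint x y by rewrite /cpoint; ring.
  have := @line_int_prim Phi (fun y => phi (cpoint x y)) (ofR x) (I_ R) c d.
  rewrite !E => <-; first by congr line_int; apply/funext => t; rewrite mulrC.
  by move=> t; rewrite E.
rewrite /rect_int mulrBr !hz ?vt//; first by ring.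
- by move=> y; apply: D; rewrite cre_cpoint; left.
- by move=> y; apply: D; rewrite cre_cpoint; right; left.
- by move=> y; apply: D; rewrite cim_cpoint; right; right; right.
- by move=> y; apply: D; rewrite cim_cpoint; right; right; left.
Qed.

End Rect.

(** * Goursat's theorem *)
Section Goursat.
Variable R : realType.
Local Notation C := (Cplx R).
Implicit Types (x y a b c d : R) (z w : C) (g : C -> C) (h : R -> C).

Lemma nested_point (u v : nat -> R) : (forall n, u n <= u n.+1) ->
  (forall n, v n.+1 <= v n) -> (forall n, u n <= v n) ->
  exists x, forall n, u n <= x <= v n.
Proof.
move=> iu dv uv.
have mu : {homo u : m n / (m <= n)%N >-> m <= n} by apply/nondecreasing_seqP.
have mv : {homo v : m n / (m <= n)%N >-> n <= m} by apply/nonincreasing_seqP.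
have uvmn m n : u m <= v n.
  apply: le_trans (mu _ _ (leq_maxl m n)) _.
  exact: le_trans (uv _) (mv _ _ (leq_maxr m n)).
have su : has_sup (range u).
  by split; [exists (u 0%N), 0%N|exists (v 0%N) => _ [m _ <-]].
exists (sup (range u)) => n; apply/andP; split.
  by apply: sup_upper_bound => //; exists n.
by apply: ge_sup; [exists (u 0%N), 0%N|move=> _ [m _ <-]].
Qed.

Record box := Box { bl : R; br : R; bd : R; bt : R }.

Definition halfbox (q q' : box) g := [/\ bl q <= bl q' <= br q' /\ br q' <= br q,
  bd q <= bd q' <= bt q' /\ bt q' <= bt q, br q' - bl q' = (br q - bl q) / 2,
  bt q' - bd q' = (bt q - bd q) / 2 &
  nrm (rect_int g (bl q) (br q) (bd q) (bt q)) <=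
  4 * nrm (rect_int g (bl q') (br q') (bd q') (bt q'))].

(** Among the four quarters of a rectangle one carries at least a quarter of
    the contour integral. The conclusion is guarded by the validity of the
    rectangle to let the axiom of choice produce a total bisection map. *)
Lemma half_exists g q : exists q', bl q <= br q -> bd q <= bt q -> halfbox q q' g.
Proof.
case: q => a b c d; have [|] := boolP ((a <= b) && (c <= d)); last first.
  by move=> /negP h; exists (Box a b c d) => /= h1 h2; case: h; rewrite h1.
move=> /andP[ab cd].
pose m := (a + b) / 2; pose k := (c + d) / 2.
have am : a <= m by rewrite /m; lra.
have mb : m <= b by rewrite /m; lra.
have ck : c <= k by rewrite /k; lra.
have kd : k <= d by rewrite /k; lra.
have L1 : m - a = (b - a) / 2 by rewrite /m; field.
have L2 : b - m = (b - a) / 2 by rewrite /m; field.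
have L3 : k - c = (d - c) / 2 by rewrite /k; field.
have L4 : d - k = (d - c) / 2 by rewrite /k; field.
pose N := nrm (rect_int g a b c d).
have : N <= nrm (rect_int g a m c k) + nrm (rect_int g a m k d)
  + (nrm (rect_int g m b c k) + nrm (rect_int g m b k d)).
  rewrite /N (rect_int_splitx _ _ _ _ _ m) !(rect_int_splity _ _ _ c d k).
  by apply: le_trans (nrmD _ _) _; apply: lerD; exact: nrmD.
move=> HN.
have [h1|h1] := leP N (4 * nrm (rect_int g a m c k)).
  by exists (Box a m c k) => _ _; split=> //=; rewrite lexx.
have [h2|h2] := leP N (4 * nrm (rect_int g a m k d)).
  by exists (Box a m k d) => _ _; split=> //=; rewrite ?lexx ?am ?ck ?kd.
have [h3|h3] := leP N (4 * nrm (rect_int g m b c k)).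
  by exists (Box m b c k) => _ _; split=> //=; rewrite ?lexx ?am ?mb ?ck ?kd.
exists (Box m b k d) => _ _; split=> //=; rewrite ?lexx ?am ?mb ?ck ?kd//.
rewrite -/N; lra.
Qed.

Lemma cderive_affine z0 (al be : C) z :
  cderive (fun z => al * z + be * (z - z0) ^+ 2 / 2) z (al + be * (z - z0)).
Proof.
move=> e e0; exists (e / (nrm be + 1)).
  by rewrite divr_gt0//; have := nrm_ge0 be; lra.
move=> h; have b1 : 0 < nrm be + 1 by have := nrm_ge0 be; lra.
rewrite ltr_pdivlMr// => hd.
have -> : al * (z + h) + be * (z + h - z0) ^+ 2 / 2 - (al * z + be * (z - z0) ^+ 2 / 2)
    - h * (al + be * (z - z0)) = be * h * h / 2 by field.
rewrite !nrmM nrmV -[X in (nrm X)^-1](ofR_nat R 2) nrm_ofR normr_nat mulrAC.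
apply: (ler_wpM2r (nrm_ge0 h)).
have := nrm_ge0 be; have := nrm_ge0 h => h0 be0.
have : nrm be * nrm h <= nrm h * (nrm be + 1) by nra.
have : 0 <= nrm be * nrm h by nra.
lra.
Qed.

Lemma continuous_affine z0 (al be : C) : continuous (fun z : C => al + be * (z - z0)).
Proof.
move=> z; apply: (@cderive_continuous _ _ _ be) => e e0; exists 1 => // h _.
have -> : al + be * (z + h - z0) - (al + be * (z - z0)) - h * be = 0 by ring.
by rewrite nrm0 mulr_ge0 ?nrm_ge0 ?ltW.
Qed.

Lemma continuous_lin k g1 g2 : continuous g1 -> continuous g2 ->
  continuous (fun z : C => k * g1 z + g2 z).
Proof.
move=> c1 c2 z; apply: (@continuousD _ _ _ (fun z => k * g1 z) g2); last exact: c2.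
by apply: (@continuousM _ _ (fun=> k) g1); [exact: cst_continuous|exact: c1].
Qed.

(** Bisection yields rectangles of diameter at most l / 2^n around a point z0
    with |integral| >= eta / 4^n. Near z0 the function differs from its affine
    part, whose contour integral vanishes, by e |z - z0|, so the integral is
    at most 4 e (l / 2^n)^2: for small e this contradicts eta > 0. *)
Lemma goursat g a b c d : continuous g -> a <= b -> c <= d ->
  (forall x y, a <= x <= b -> c <= y <= d -> exists D, cderive g (cpoint x y) D) ->
  rect_int g a b c d = 0.
Proof.
move=> cg ab cd dg.
have [step hstep] := choice (half_exists g).
pose q n := iter n step (Box a b c d).
have qv n : bl (q n) <= br (q n) /\ bd (q n) <= bt (q n).
  elim: n => [|n [h1 h2]] //=.
  by have [[/andP[_ ->] _] [/andP[_ ->] _] _ _ _] := hstep _ h1 h2.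
have qs n : halfbox (q n) (q n.+1) g by have [h1 h2] := qv n; exact: hstep.
have [x hx] : exists x, forall n, bl (q n) <= x <= br (q n).
  apply: nested_point => n.
  - by have [[/andP[-> _] _] _ _ _ _] := qs n.
  - by have [[/andP[_ _] ->] _ _ _ _] := qs n.
  - by have [] := qv n.
have [y hy] : exists y, forall n, bd (q n) <= y <= bt (q n).
  apply: nested_point => n.
  - by have [_ [/andP[-> _] _] _ _ _] := qs n.
  - by have [_ [/andP[_ _] ->] _ _ _] := qs n.
  - by have [] := qv n.
pose l := (b - a) + (d - c).
pose ln n := (br (q n) - bl (q n)) + (bt (q n) - bd (q n)).
have lnE n : ln n = l / 2 ^+ n.
  elim: n => [|n IH]; first by rewrite expr0 divr1.
  have [_ _ h1 h2 _] := qs n.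
  by rewrite /ln h1 h2 -mulrDl -/(ln n) IH exprS invfM mulrA mulrAC.
pose In n := rect_int g (bl (q n)) (br (q n)) (bd (q n)) (bt (q n)).
have Ile n : nrm (rect_int g a b c d) <= 4 ^+ n * nrm (In n).
  elim: n => [|n IH]; first by rewrite expr0 mul1r.
  apply: le_trans IH _; rewrite exprSr -mulrA ler_wpM2l ?exprn_ge0//.
  by have [_ _ _ _] := qs n.
have l0 : 0 <= l by rewrite /l; lra.
have [D hD] := dg x y (hx 0%N) (hy 0%N).
apply/eqP; rewrite -nrm_eq0; apply/negP => /negP I0.
have {}I0 : 0 < nrm (rect_int g a b c d) by rewrite lt_neqAle eq_sym I0 nrm_ge0.
set eta := nrm _ in I0.
have den : 0 < 4 * l ^+ 2 + 1 by have := sqr_ge0 l; lra.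
(* with e = eta / (4 l^2 + 1) the bound 4 e l^2 falls strictly below eta *)
have [del del0 H] := hD _ (divr_gt0 I0 den).
have [n hn] : exists n : nat, l / 2 ^+ n < del.
  pose n := (Num.truncn (l / del)).+1; exists n.
  rewrite ltr_pdivrMr ?exprn_gt0//.
  have := truncnS_gt (l / del); rewrite ltr_pdivrMr// => h; apply: lt_le_trans h _.
  rewrite mulrC ler_wpM2l ?(ltW del0)// -natrX ler_nat.
  exact: ltnW (ltn_expl _ _).
pose z0 := cpoint x y.
pose af z := g z0 + D * (z - z0).
have [q1 q2] := qv n.
have Iaf : rect_int af (bl (q n)) (br (q n)) (bd (q n)) (bt (q n)) = 0.
  apply: (rect_int_prim (Phi := fun z => g z0 * z + D * (z - z0) ^+ 2 / 2)).
    by apply: continuous_edge; exact: continuous_affine.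
  by move=> z _; exact: cderive_affine.
have caf : continuous af by exact: continuous_affine.
have cgaf : continuous (fun z => (-1) * af z + g z).
  exact: (@continuous_lin (-1) af g caf cg).
have Ig : rect_int (fun z => (-1) * af z + g z)
    (bl (q n)) (br (q n)) (bd (q n)) (bt (q n)) = In n.
  rewrite (rect_int_lin _ (continuous_edge _ _ _ _ caf) (continuous_edge _ _ _ _ cg)).
  by rewrite Iaf mulr0 add0r.
have : nrm (In n) <= 4 * (eta / (4 * l ^+ 2 + 1) * ln n) * ln n.
  rewrite -Ig /ln; apply: rect_int_bound => //; first exact: continuous_edge.
  move=> z [[/andP[z1 z2] /andP[z3 z4]] _]; rewrite -/(ln n).
  have zl : nrm (z - z0) <= ln n.
    apply: le_trans (nrm_reim _) _; rewrite creD cimD creN cimN cre_cpoint cim_cpoint /ln.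
    have /andP[x1 x2] := hx n; have /andP[y1 y2] := hy n.
    by apply: lerD; rewrite ler_norml; apply/andP; split; lra.
  have zd : nrm (z - z0) < del by apply: le_lt_trans zl _; rewrite lnE.
  have := H _ zd; rewrite -/z0 subrKC => HH.
  have -> : -1 * af z + g z = g z - g z0 - (z - z0) * D by rewrite /af; ring.
  apply: le_trans HH _; apply: ler_wpM2l zl; exact: ltW (divr_gt0 _ _).
rewrite lnE => HI.
have := Ile n; rewrite -/eta => h1.
have : eta <= 4 ^+ n * (4 * (eta / (4 * l ^+ 2 + 1) * (l / 2 ^+ n)) * (l / 2 ^+ n)).
  by apply: le_trans h1 _; rewrite ler_wpM2l ?exprn_ge0.
have -> : (4 : R) ^+ n = 2 ^+ n * 2 ^+ n by rewrite -exprMn -natrM.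
have p0 : (2 : R) ^+ n != 0 by rewrite expf_neq0.
have -> : 2 ^+ n * 2 ^+ n * (4 * (eta / (4 * l ^+ 2 + 1) * (l / 2 ^+ n)) * (l / 2 ^+ n)) =
  eta * (4 * l ^+ 2) / (4 * l ^+ 2 + 1).
  by field; rewrite p0 lt0r_neq0.
rewrite leNgt => /negP; apply.
by rewrite ltr_pdivrMr// mulrDr mulr1 ltrDl.
Qed.

(** Cutting along four lines at distance e from z0 leaves only the small square
    around z0, whose contour integral is O(e) because g is bounded there. *)
Lemma goursat_punctured g z0 a b c d : continuous g ->
  a < cre z0 < b -> c < cim z0 < d ->
  (forall z, z != z0 -> exists D, cderive g z D) ->
  rect_int g a b c d = 0.
Proof.
move=> cg /andP[az zb] /andP[cz zd] dg.
set x := cre z0 in az zb *; set y := cim z0 in cz zd *.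
have G a' b' c' d' : a' <= b' -> c' <= d' ->
    b' < x \/ x < a' \/ d' < y \/ y < c' -> rect_int g a' b' c' d' = 0.
  move=> ab cd h; apply: goursat => // x' y' /andP[h1 h2] /andP[h3 h4].
  apply: dg; apply/eqP => E; move: h; rewrite /x /y -E cre_cpoint cim_cpoint.
  by case=> [|[|[|]]]; rewrite ltNge => /negP; apply.
have [d1 d10 H1] : exists2 d, 0 < d & forall w, nrm (w - z0) < d -> nrm (g w - g z0) < 1.
  by apply/near_nrmP; have /cvg_nrmP/(_ 1 ltr01) := cg z0.
pose M := nrm (g z0) + 1.
apply/eqP; rewrite -nrm_eq0 -[_ == 0]negbK; apply/negP => I0.
have {}I0 : 0 < nrm (rect_int g a b c d) by rewrite lt_neqAle eq_sym I0 nrm_ge0.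
set eta := nrm _ in I0.
have M0 : 0 < M by rewrite /M; have := nrm_ge0 (g z0); lra.
have [e [[e0 ea eb ec] [ed ed1 eM]]] : exists e, [/\ 0 < e, a < x - e, x + e < b & c < y - e]
    /\ [/\ y + e < d, 2 * e < d1 & 16 * M * e < eta].
  pose e := Num.min (Num.min (Num.min (x - a) (b - x)) (Num.min (y - c) (d - y)))
    (Num.min (d1 / 2) (eta / (16 * M))) / 2.
  have e0 : 0 < e.
    by rewrite /e divr_gt0// !lt_min !subr_gt0 az zb cz zd !divr_gt0// mulr_gt0.
  have : e * 2 <= Num.min (Num.min (Num.min (x - a) (b - x)) (Num.min (y - c) (d - y)))
    (Num.min (d1 / 2) (eta / (16 * M))) by rewrite /e divfK.
  rewrite !le_min -!andbA => /and5P[h1 h2 h3 h4 /andP[h5 h6]].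
  exists e; split; split=> //; try lra.
  have : e < eta / (16 * M) by lra.
  by rewrite ltr_pdivlMr ?mulr_gt0// mulrC.
have Z : rect_int g a b c d = rect_int g (x - e) (x + e) (y - e) (y + e).
  rewrite (rect_int_splitx _ _ _ _ _ (x - e)) (rect_int_splitx _ (x - e) _ _ _ (x + e)).
  rewrite (rect_int_splity _ (x - e) _ _ _ (y - e)).
  rewrite (rect_int_splity _ (x - e) _ (y - e) _ (y + e)).
  have -> : rect_int g a (x - e) c d = 0.
    by apply: G; [lra|lra|left; lra].
  have -> : rect_int g (x + e) b c d = 0.
    by apply: G; [lra|lra|right; left; lra].
  have -> : rect_int g (x - e) (x + e) c (y - e) = 0.
    by apply: G; [lra|lra|right; right; left; lra].
  have -> : rect_int g (x - e) (x + e) (y + e) d = 0.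
    by apply: G; [lra|lra|right; right; right; lra].
  by rewrite !add0r !addr0.
have := @rect_int_bound _ g (x - e) (x + e) (y - e) (y + e) M.
rewrite -Z -/eta => HB.
have : eta <= 4 * M * (x + e - (x - e) + (y + e - (y - e))).
  apply: HB; [lra|lra|exact: continuous_edge|].
  move=> z [[/andP[z1 z2] /andP[z3 z4]] _].
  have : nrm (z - z0) < d1.
    apply: le_lt_trans (nrm_reim _) _; rewrite creD cimD creN cimN -/x -/y.
    apply: le_lt_trans ed1; have -> : 2 * e = e + e by ring.
    by apply: lerD; rewrite ler_norml; apply/andP; split; lra.
  move=> /H1 h; have := nrmD (g z - g z0) (g z0); rewrite subrK /M; lra.
have -> : 4 * M * (x + e - (x - e) + (y + e - (y - e))) = 16 * M * e by ring.
lra.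
Qed.

End Goursat.

(** * Series dominated by a geometric series *)
Section Series.
Variable R : realType.
Local Notation C := (Cplx R).
Implicit Types (u v : nat -> C) (P : R).

Definition csum u : C := limn (series u).

Lemma csum_unique u l : series u @ \oo --> l -> csum u = l.
Proof. by move=> h; apply/cvg_lim. Qed.

Lemma half_small P (e : R) : 0 < e -> \forall n \near \oo, P / 2 ^+ n < e.
Proof.
move=> e0.
have : (fun n : nat => P * (1 / 2) ^+ n) @ \oo --> P * 0.
  apply: cvgM; first exact: cvg_cst.
  by apply: cvg_expr; rewrite ger0_norm//; lra.
rewrite mulr0 => /cvgrPdist_lt/(_ e e0); apply: filterS => n.
rewrite sub0r normrN expr_div_n expr1n mul1r.
by apply: le_lt_trans; exact: ler_norm.
Qed.

Lemma geom_sum P N M : 0 <= P ->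
  \sum_(N <= k < M) P / 2 ^+ k <= 2 * P / 2 ^+ N.
Proof.
move=> P0; have [NM|MN] := leqP N M; last first.
  by rewrite big_geq ?(ltnW MN)// divr_ge0 ?mulr_ge0 ?exprn_ge0.
suff -> : \sum_(N <= k < M) P / 2 ^+ k = 2 * P / 2 ^+ N - 2 * P / 2 ^+ M.
  by rewrite gerBl divr_ge0 ?mulr_ge0 ?exprn_ge0.
elim: M NM => [|M IH]; first by rewrite leqn0 => /eqP ->; rewrite big_geq// subrr.
rewrite leq_eqVlt => /predU1P[->|]; first by rewrite big_geq// subrr.
rewrite ltnS => NM; rewrite big_nat_recr//= IH// exprS.
by field; rewrite !expf_neq0.
Qed.

Lemma dom_ge0 P u : (forall n, nrm (u n) <= P / 2 ^+ n) -> 0 <= P.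
Proof. by move=> /(_ 0%N); rewrite expr0 divr1; apply: le_trans; exact: nrm_ge0. Qed.

Lemma series_tail P u N M : (forall n, nrm (u n) <= P / 2 ^+ n) -> (N <= M)%N ->
  nrm (series u M - series u N) <= 2 * P / 2 ^+ N.
Proof.
move=> uP NM; have P0 := dom_ge0 uP.
rewrite sub_series_geq// (le_trans (nrm_sum _ _ _))// (le_trans _ (geom_sum N M P0))//.
exact: ler_sum.
Qed.

Lemma csum_cvg P u : (forall n, nrm (u n) <= P / 2 ^+ n) -> series u @ \oo --> csum u.
Proof.
move=> uP; have P0 := dom_ge0 uP.
have aux (p : C -> R) : (forall z, `|p z| <= nrm z) -> cvgn (series (fun n => p (u n))).
  move=> ple; apply: normed_cvg; apply: (@series_le_cvg _ _ (geometric P (1 / 2))) => //.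
  - by move=> n; exact: normr_ge0.
  - by move=> n; rewrite /geometric/= mulr_ge0// exprn_ge0//; lra.
  - move=> n; apply: le_trans (ple _) _.
    by rewrite /geometric/= expr_div_n expr1n mul1r; exact: uP.
  - by apply: is_cvg_geometric_series; rewrite ger0_norm//; lra.
have hre := aux _ (@cre_le R); have him := aux _ (@cim_le R).
apply/cvg_ex; exists (cpoint (limn (series (fun n => cre (u n))))
  (limn (series (fun n => cim (u n))))).
have -> : series u = (fun n => cpoint (series (fun n => cre (u n)) n)
    (series (fun n => cim (u n)) n)).
  apply/funext => n; rewrite !seriesEnat; apply: c_eq.
    rewrite cre_cpoint; exact: (big_morph (@cre R) (@creD R) (erefl _)).
  rewrite cim_cpoint; exact: (big_morph (@cim R) (@cimD R) (erefl _)).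
apply: cvgD; first by apply: continuous_cvg; [exact: ofR_continuous|exact: hre].
apply: cvgM; first exact: cvg_cst.
by apply: continuous_cvg; [exact: ofR_continuous|exact: him].
Qed.

Lemma csum_tail P u N : (forall n, nrm (u n) <= P / 2 ^+ n) ->
  nrm (csum u - series u N) <= 2 * P / 2 ^+ N.
Proof.
move=> uP; apply/ler_addgt0Pr => e e0.
have /cvg_nrmP/(_ e e0) := csum_cvg uP.
move=> [M _ HM]; have := HM (maxn M N) (leq_maxl _ _) => /= h.
have h1 := series_tail uP (leq_maxr M N).
have h2 := nrmD (csum u - series u (maxn M N)) (series u (maxn M N) - series u N).
rewrite addrA subrK in h2; rewrite nrmB in h; lra.
Qed.

Lemma csum_le P u : (forall n, nrm (u n) <= P / 2 ^+ n) -> nrm (csum u) <= 2 * P.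
Proof.
move=> uP; have := csum_tail 0 uP.
by rewrite seriesEnat/= big_geq// subr0 expr0 divr1.
Qed.

Lemma series_lin k u v :
  series (fun n => k * u n + v n) = (fun n => k * series u n + series v n).
Proof.
by apply/funext => n; rewrite !seriesEnat/= big_split/= big_distrr.
Qed.

Lemma cvg_lin (T : Type) (F : set_system T) {FF : Filter F} k (f g : T -> C) (a b : C) :
  f x @[x --> F] --> a -> g x @[x --> F] --> b -> (k * f x + g x) @[x --> F] --> k * a + b.
Proof.
move=> fa gb; apply: (@cvgD _ _ _ _ _ (fun x => k * f x) g (k * a) b _ gb).
exact: (@cvgM _ _ _ _ (fun=> k) f k a (cvg_cst _) fa).
Qed.

Lemma cvg_series_lin k u v (a b : C) : series u @ \oo --> a -> series v @ \oo --> b ->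
  series (fun n => k * u n + v n) @ \oo --> k * a + b.
Proof. by move=> ua vb; rewrite series_lin; exact: (@cvg_lin _ _ _ k _ _ _ _ ua vb). Qed.

Lemma cvg_series0 : series (fun _ : nat => 0 : C) @ \oo --> (0 : C).
Proof.
have -> : series (fun _ : nat => 0 : C) = (fun _ => 0).
  by apply/funext => n; rewrite seriesEnat/= big1.
exact: cvg_cst.
Qed.

Lemma cvg_series_scale k u (a : C) : series u @ \oo --> a ->
  series (fun n => k * u n) @ \oo --> k * a.
Proof.
move=> ua; have := @cvg_series_lin k _ _ _ _ ua cvg_series0; rewrite addr0.
by have -> : (fun n => k * u n + 0) = (fun n => k * u n) by apply/funext => n; rewrite addr0.
Qed.

Lemma series_recl u n : series u n.+1 = u 0%N + series (fun n => u n.+1) n.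
Proof. by rewrite !seriesEnat/= big_nat_recl. Qed.

(** Both directions are used to peel off or to restore the term of index 0. *)
Lemma cvg_series_shift u l :
  series u @ \oo --> l <-> series (fun n => u n.+1) @ \oo --> l - u 0%N.
Proof.
split.
  move=> h; have : series u n.+1 @[n --> \oo] --> l by rewrite cvg_shiftS.
  move=> h2; have -> : series (fun n => u n.+1) = (fun n => series u n.+1 - u 0%N).
    by apply/funext => n; rewrite series_recl addrC addKr.
  exact: (@cvgB _ _ _ _ _ _ (fun=> u 0%N) _ _ h2 (cvg_cst _)).
move=> h; rewrite -cvg_shiftS.
have -> : (fun n => series u n.+1) = (fun n => u 0%N + series (fun n => u n.+1) n).
  by apply/funext => n; rewrite series_recl.
rewrite -[l](subrKC (u 0%N)).
exact: (@cvgD _ _ _ _ _ (fun=> u 0%N) _ _ _ (cvg_cst _) h).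
Qed.

Lemma cvg_nrm_le (x : nat -> C) l (P : R) :
  (forall n, nrm (x n - l) <= P / 2 ^+ n) -> x @ \oo --> l.
Proof.
move=> H; apply/cvg_nrmP => e e0; apply: filterS (half_small P e0) => n.
exact: le_lt_trans (H n).
Qed.

(** The lattice points of the triangle n + k < N, counted by diagonals and by
    rows. *)
Lemma series_diag (a : nat -> nat -> C) N :
  series (fun m => \sum_(n < m.+1) a n (m - n)%N) N = \sum_(n < N) series (a n) (N - n)%N.
Proof.
rewrite seriesEnat/=; elim: N => [|N IH]; first by rewrite big_geq// big_ord0.
rewrite big_nat_recr//= IH !big_ord_recr/= subnn subSnn addrA -big_split/=; congr (_ + _).
  by apply: eq_bigr => n _; rewrite subSn ?(ltnW (ltn_ord _))// !seriesEnat/= big_nat_recr.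
by rewrite seriesEnat/= big_nat1.
Qed.

(** Under a bound P / 4^(n+k) the row sum over k < N - n misses its limit by
    at most 2 (P / 4^n) / 2^(N-n) <= (2 P / 2^N) / 2^n, and these errors sum
    over n to O(2^-N). *)
Lemma csum_diag (a : nat -> nat -> C) P :
  (forall n k, nrm (a n k) <= P / 4 ^+ (n + k)) ->
  series (fun m => \sum_(n < m.+1) a n (m - n)%N) @ \oo --> csum (fun n => csum (a n)).
Proof.
move=> aP.
have P0 : 0 <= P.
  by have := aP 0%N 0%N; rewrite expr0 divr1; apply: le_trans; exact: nrm_ge0.
have p2 n : (2 : R) ^+ n != 0 by rewrite expf_neq0.
have p20 n : 0 < (2 : R) ^+ n by rewrite exprn_gt0.
have p21 n : 1 <= (2 : R) ^+ n by rewrite exprn_ege1//; lra.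
have E4 n : (4 : R) ^+ n = 2 ^+ n * 2 ^+ n by rewrite -exprMn -natrM.
have domn n k : nrm (a n k) <= P / 4 ^+ n / 2 ^+ k.
  apply: le_trans (aP n k) _; rewrite -mulrA -invfM ler_wpM2l//.
  rewrite lef_pV2 ?posrE ?mulr_gt0 ?exprn_gt0// exprD (E4 k).
  by rewrite ler_wpM2l ?exprn_ge0// ler_peMr// ltW.
have dA n : nrm (csum (a n)) <= (2 * P) / 2 ^+ n.
  apply: le_trans (csum_le (domn n)) _.
  rewrite mulrA ler_wpM2l ?mulr_ge0// lef_pV2 ?posrE ?exprn_gt0// E4.
  by rewrite ler_peMr// ltW.
apply: (@cvg_nrm_le _ _ (8 * P)) => N; rewrite series_diag.
have h1 := csum_tail N dA.
have h2 : nrm (series (fun n => csum (a n)) N - \sum_(n < N) series (a n) (N - n)%N)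
    <= 4 * P / 2 ^+ N.
  rewrite seriesEnat/= big_mkord -sumrB (le_trans (nrm_sum _ _ _))//.
  apply: (@le_trans _ _ (\sum_(n < N) (2 * P / 2 ^+ N) / 2 ^+ n)).
    apply: ler_sum => n _; apply: le_trans (csum_tail _ (domn n)) _.
    have -> : (2:R) ^+ N = 2 ^+ (N - n) * 2 ^+ n by rewrite -exprD subnK// ltnW.
    rewrite E4 -!mulrA !ler_wpM2l//.
    rewrite -!invfM lef_pV2 ?posrE ?mulr_gt0//.
    by rewrite le_eqVlt; apply/orP; left; apply/eqP; ring.
  have := @geom_sum (2 * P / 2 ^+ N) 0 N (divr_ge0 (mulr_ge0 _ P0) (exprn_ge0 _ _)).
  rewrite big_mkord expr0 divr1 => h; apply: le_trans (h _ _) _ => //.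
  by rewrite !mulrA -natrM.
have h3 := nrmD (csum (fun n => csum (a n)) - series (fun n => csum (a n)) N)
 (series (fun n => csum (a n)) N - \sum_(n < N) series (a n) (N - n)%N).
rewrite addrA subrK in h3; rewrite nrmB.
apply: le_trans h3 _; apply: le_trans (lerD h1 h2) _.
by rewrite -mulrDl ler_wpM2r ?invr_ge0 ?exprn_ge0//; lra.
Qed.

End Series.

(** * Cauchy's formula on a square and expansion at the origin *)
Section Cauchy.
Variable R : realType.
Local Notation C := (Cplx R).
Implicit Types (z w : C) (f g : C -> C) (r : R).

Definition square_int f r := rect_int f (- r) r (- r) r.
Definition on_lines (a b c d : R) z := cre z = a \/ cre z = b \/ cim z = c \/ cim z = d.

Lemma rect_int_ext f g a b c d : (forall z, on_lines a b c d z -> f z = g z) ->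
  rect_int f a b c d = rect_int g a b c d.
Proof.
move=> fg; rewrite /rect_int.
congr (line_int _ _ _ - line_int _ _ _ + _ * (line_int _ _ _ - line_int _ _ _));
  apply/funext => t; apply: fg; rewrite /on_lines cre_cpoint cim_cpoint; tauto.
Qed.

Lemma edge_cont_lines g a b c d :
  (forall z, on_lines a b c d z -> {for z, continuous g}) -> edge_cont g a b c d.
Proof.
move=> cg; split=> t.
- apply: (@continuous_comp _ _ _ (fun x => cpoint x c) g); first exact: hline_continuous.
  by apply: cg; rewrite /on_lines cre_cpoint cim_cpoint; tauto.
- apply: (@continuous_comp _ _ _ (fun x => cpoint x d) g); first exact: hline_continuous.
  by apply: cg; rewrite /on_lines cre_cpoint cim_cpoint; tauto.
- apply: (@continuous_comp _ _ _ (fun x => cpoint a x) g); first exact: vline_continuous.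
  by apply: cg; rewrite /on_lines cre_cpoint cim_cpoint; tauto.
- apply: (@continuous_comp _ _ _ (fun x => cpoint b x) g); first exact: vline_continuous.
  by apply: cg; rewrite /on_lines cre_cpoint cim_cpoint; tauto.
Qed.

Lemma lines_ge r z : 0 < r -> on_lines (- r) r (- r) r z -> r <= nrm z.
Proof.
move=> r0; have := cre_le z; have := cim_le z => h1 h2.
case=> [E|[E|[E|E]]].
- by apply: le_trans h2; rewrite E normrN (ger0_norm (ltW r0)).
- by apply: le_trans h2; rewrite E (ger0_norm (ltW r0)).
- by apply: le_trans h1; rewrite E normrN (ger0_norm (ltW r0)).
- by apply: le_trans h1; rewrite E (ger0_norm (ltW r0)).
Qed.

Lemma edge_ge r z : 0 < r -> on_edge (- r) r (- r) r z -> r <= nrm z <= 2 * r.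
Proof.
move=> r0 [[h1 h2] h3]; rewrite lines_ge//=.
apply: le_trans (nrm_reim _) _; move: h1 h2; rewrite -!ler_norml; lra.
Qed.

Lemma ge_neq r z w : nrm w < r -> r <= nrm z -> z != w.
Proof. by move=> wr rz; apply: contraTneq rz => ->; rewrite -ltNge. Qed.

Lemma edge_bounded g a b c d : a <= b -> c <= d -> edge_cont g a b c d ->
  exists M, forall z, on_edge a b c d z -> nrm (g z) <= M.
Proof.
move=> ab cd [c1 c2 c3 c4].
have aux (h : R -> C) (u v : R) : u <= v -> continuous h ->
    exists M, forall t, u <= t <= v -> nrm (h t) <= M.
  move=> uv ch.
  have [|x _ hx] := @EVT_max R (fun t => nrm (h t)) u v uv _.
    apply: continuous_subspaceT => t.
    by apply: (@continuous_comp _ _ _ h); [exact: ch|exact: nrm_continuous].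
  by exists (nrm (h x)) => t tuv; apply: hx; rewrite in_itv.
have [M1 H1] := aux _ _ _ ab c1; have [M2 H2] := aux _ _ _ ab c2.
have [M3 H3] := aux _ _ _ cd c3; have [M4 H4] := aux _ _ _ cd c4.
exists (Num.max (Num.max M1 M2) (Num.max M3 M4)) => z [[h1 h2] h3].
rewrite -(cpoint_eta z) !le_max.
case: h3 => [E|[E|[E|E]]]; rewrite E.
- by rewrite H3// !orbT.
- by rewrite H4// !orbT.
- by rewrite H1.
- by rewrite H2// !orbT.
Qed.

Definition holo f z := exists D, cderive f z D.

Lemma holo_continuous f z : holo f z -> {for z, continuous f}.
Proof. by move=> [D]; exact: cderive_continuous. Qed.

Lemma holoM f g z : holo f z -> holo g z -> holo (fun z => f z * g z) z.
Proof.
move=> /derivable_cderiveP df /derivable_cderiveP dg.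
by apply/derivable_cderiveP; exact: (derivableM df dg).
Qed.
Lemma holo_cst k z : holo (fun _ => k) z.
Proof. by apply/derivable_cderiveP; exact: derivable_cst. Qed.
Lemma holo_id z : holo (fun z => z) z.
Proof. by apply/derivable_cderiveP; exact: derivable_id. Qed.
Lemma holoB f g z : holo f z -> holo g z -> holo (fun z => f z - g z) z.
Proof.
move=> /derivable_cderiveP df /derivable_cderiveP dg.
by apply/derivable_cderiveP; exact: (derivableB df dg).
Qed.
Lemma holoV f z : f z != 0 -> holo f z -> holo (fun z => (f z)^-1) z.
Proof.
move=> f0 /derivable_cderiveP df.
by apply/derivable_cderiveP; exact: (derivableV f0 df).
Qed.
Lemma holoX f n z : holo f z -> holo (fun z => f z ^+ n) z.
Proof.
move=> df; elim: n => [|n IH]; first exact: (holo_cst 1).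
by under eq_fun do rewrite exprS; exact: holoM.
Qed.

Lemma cderiveVX n z : z != 0 ->
  cderive (fun z => - n.+1%:R^-1 * z^-1 ^+ n.+1) z (z^-1 ^+ n.+2).
Proof.
move=> z0.
have H1 : is_derive z 1 (fun z : C => z^-1) (- z ^- 2 *: 1).
  apply: DeriveDef.
    exact: (@derivableV _ _ (fun z : C => z) z 1 z0 (@derivable_id _ _ _ _)).
  by rewrite (@deriveV _ _ (fun z : C => z) z 1 z0 (@derivable_id _ _ _ _)) derive_id.
have H2 : is_derive z 1 ((- n.+1%:R^-1) *: (fun z : C => z^-1) ^+ n.+1)
   (- n.+1%:R^-1 *: ((n.+1%:R * z^-1 ^+ n) *: (- z ^- 2 *: 1))).
  by apply: is_deriveZ; apply: is_deriveX.
case: H2 => H2 H3.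
have E : (fun z => - n.+1%:R^-1 * z^-1 ^+ n.+1) =
    ((- n.+1%:R^-1) *: (fun z : C => z^-1) ^+ n.+1).
  apply/funext => y; rewrite [RHS]/GRing.scale/=; congr (_ * _).
  by elim: n.+1 => [//|m IH]; rewrite !exprS IH.
rewrite E.
have -> : z^-1 ^+ n.+2 = derive1 (- n.+1%:R^-1 *: (fun z : C => z^-1) ^+ n.+1) z.
  rewrite derive1E H3 /GRing.scale/= mulr1 -!exprVn.
  rewrite mulrN mulrNN -mulrA mulKf ?pnatr_eq0// -exprD addn2//.
exact: derivable_cderive.
Qed.

Section Square.
Variables (r : R) (r0 : 0 < r).
Local Notation L := (on_lines (- r) r (- r) r).
Local Notation E := (on_edge (- r) r (- r) r).

Let rr : - r <= r. Proof. by have := r0; lra. Qed.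

Lemma square_int_lin k f g :
  (forall z, r <= nrm z -> holo f z) -> (forall z, r <= nrm z -> holo g z) ->
  square_int (fun z => k * f z + g z) r = k * square_int f r + square_int g r.
Proof.
move=> hf hg; apply: rect_int_lin; apply: edge_cont_lines => z /(lines_ge r0) h;
 apply: holo_continuous; by [exact: hf|exact: hg].
Qed.

Lemma square_int_bound f M :
  (forall z, r <= nrm z -> holo f z) -> (forall z, E z -> nrm (f z) <= M) ->
  nrm (square_int f r) <= 16 * M * r.
Proof.
move=> hf fM; apply: (@le_trans _ _ (4 * M * ((r - - r) + (r - - r)))); last first.
  by rewrite le_eqVlt; apply/orP; left; apply/eqP; ring.
apply: rect_int_bound => //; apply: edge_cont_lines => z /(lines_ge r0) h.
exact/holo_continuous/hf.
Qed.

Lemma cre_inv z : cre z^-1 = cre z / (cre z ^+ 2 + cim z ^+ 2).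
Proof. by case: z. Qed.
Lemma cim_inv z : cim z^-1 = - cim z / (cre z ^+ 2 + cim z ^+ 2).
Proof. by case: z => a b; rewrite mulNr. Qed.

(** The exact value is 2 i pi. On each of the four sides the imaginary part of
    the oriented integrand is r / (t^2 + r^2) >= 1 / (2 r), and a side has length 2 r. *)
Lemma square_int_inv : 4 <= nrm (square_int (fun z => z^-1) r).
Proof.
have [c1 c2 c3 c4] : edge_cont (fun z : C => z^-1) (- r) r (- r) r.
  apply: edge_cont_lines => z /(lines_ge r0) h; apply/holo_continuous/holoV => //.
    by rewrite -nrm_gt0 (lt_le_trans r0 h).
  exact: holo_id.
apply: le_trans (cim_le _); apply: le_trans (ler_norm _).
have cJ h (a b : R) : cim (line_int h a b) = rint (fun t => cim (h t)) a b.
  by rewrite /line_int cimD cimM cim_ofR cre_I cim_I cim_ofR cre_ofR; ring.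
have rJ h (a b : R) : cre (line_int h a b) = rint (fun t => cre (h t)) a b.
  by rewrite /line_int creD creM cre_ofR cre_I cim_I cim_ofR; ring.
have den t : 0 < t ^+ 2 + r ^+ 2 by rewrite ltr_wpDl ?sqr_ge0 ?exprn_gt0.
have q1 t : - r <= t <= r -> (2 * r)^-1 <= r / (t ^+ 2 + r ^+ 2) <= r^-1.
  move=> /andP[t1 t2]; apply/andP; split.
    rewrite ler_pdivlMr// ler_pdivrMl ?mulr_gt0//; nra.
  rewrite ler_pdivrMr// ler_pdivlMl//; have := sqr_ge0 t; rewrite expr2; nra.
have aux (h : R -> R) : continuous h -> (forall t, h t = r / (t ^+ 2 + r ^+ 2)) ->
    1 <= rint h (- r) r.
  move=> ch hE.
  have B t : - r <= t <= r -> (2 * r)^-1 <= h t <= r^-1 by move=> tr; rewrite hE q1.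
  have /andP[+ _] := rint_bound rr ch B.
  by have -> : (2 * r)^-1 * (r - - r) = 1 by field; rewrite lt0r_neq0.
have auxN (h : R -> R) : continuous h -> (forall t, h t = - (r / (t ^+ 2 + r ^+ 2))) ->
    rint h (- r) r <= - 1.
  move=> ch hE.
  have B t : - r <= t <= r -> - r^-1 <= h t <= - (2 * r)^-1.
    by move=> tr; rewrite hE !lerN2 andbC q1.
  have /andP[_ +] := rint_bound rr ch B.
  by have -> : - (2 * r)^-1 * (r - - r) = - 1 by field; rewrite lt0r_neq0.
have cimE4 (A B X Y : C) : cim (A - B + I_ R * (X - Y)) = cim A - cim B + (cre X - cre Y).
  by rewrite !cimD cimM cimN cre_I cim_I creD creN; ring.
rewrite /square_int /rect_int cimE4 !cJ !rJ.
have h1 := aux _ (cont_im c1); have h2 := auxN _ (cont_im c2).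
have h3 := auxN _ (cont_re c3); have h4 := aux _ (cont_re c4).
have {}h1 := h1 _; have {}h2 := h2 _; have {}h3 := h3 _; have {}h4 := h4 _.
have E1 : forall t, cim (cpoint t (- r))^-1 = r / (t ^+ 2 + r ^+ 2).
  by move=> t; rewrite cim_inv cre_cpoint cim_cpoint opprK sqrrN.
have E2 : forall t, cim (cpoint t r)^-1 = - (r / (t ^+ 2 + r ^+ 2)).
  by move=> t; rewrite cim_inv cre_cpoint cim_cpoint mulNr.
have E3 : forall t, cre (cpoint (- r) t)^-1 = - (r / (t ^+ 2 + r ^+ 2)).
  by move=> t; rewrite cre_inv cre_cpoint cim_cpoint mulNr sqrrN addrC.
have E4 : forall t, cre (cpoint r t)^-1 = r / (t ^+ 2 + r ^+ 2).
  by move=> t; rewrite cre_inv cre_cpoint cim_cpoint addrC.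
by move: (h1 E1) (h2 E2) (h3 E3) (h4 E4); lra.
Qed.

(** Powers of 1/z beyond the first have a primitive off the origin. *)
Lemma square_int_invX n : square_int (fun z => z^-1 ^+ n.+2) r = 0.
Proof.
have nz z : L z -> z != 0 by move=> /(lines_ge r0) h; rewrite -nrm_gt0 (lt_le_trans r0 h).
apply: (rect_int_prim (Phi := fun z => - n.+1%:R^-1 * z^-1 ^+ n.+1)).
  apply: edge_cont_lines => z /nz h; apply: holo_continuous; apply: holoX.
  by apply: holoV => //; exact: holo_id.
by move=> z Lz; apply: cderiveVX; exact: nz.
Qed.

Lemma continuous_nrm g z : (forall e, 0 < e -> exists2 d, 0 < d &
  forall w, nrm (w - z) < d -> nrm (g w - g z) < e) -> {for z, continuous g}.
Proof.
move=> H; have FF : Filter (nbhs (z : C)) by exact: nbhs_filter.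
by apply/(@cvg_nrmP _ _ (nbhs (z : C)) FF) => e e0; apply/near_nrmP; exact: H.
Qed.

(** The quotient (f z - f w) / (z - w), continued at w by the derivative, is
    continuous everywhere and differentiable off w, so its integral is 0. *)
Lemma cauchy_formula f w : (forall z, holo f z) -> nrm w < r ->
  square_int (fun z => f z / (z - w)) r = f w * square_int (fun z => (z - w)^-1) r.
Proof.
move=> hf wr; have [D HD] := hf w.
have hi z : r <= nrm z -> holo (fun z => (z - w)^-1) z.
  move=> rz; apply: holoV; first by rewrite subr_eq0 (ge_neq wr rz).
  by apply: holoB; [exact: holo_id|exact: holo_cst].
pose g z := if z == w then D else (f z - f w) / (z - w).
have dg z : z != w -> holo g z.
  move=> zw.
  have [D' HD'] : holo (fun z => (f z - f w) / (z - w)) z.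
    apply: holoM; first by apply: holoB => //; exact: holo_cst.
    apply: holoV; first by rewrite subr_eq0.
    by apply: holoB; [exact: holo_id|exact: holo_cst].
  exists D' => e e0; have [del del0 H] := HD' e e0.
  exists (Num.min del (nrm (z - w))).
    by rewrite lt_min del0 nrm_gt0 subr_eq0.
  move=> h; rewrite lt_min => /andP[/H hd hw]; rewrite /g (negbTE zw).
  case: eqP => // E; move: hw; rewrite -E nrmB (_ : z + h - z = h) ?ltxx//; ring.
have cg : continuous g.
  move=> z; have [->|zw] := eqVneq z w; last exact/holo_continuous/dg.
  apply: continuous_nrm => e e0; rewrite {2}/g eqxx.
  have [del del0 H] := HD (e / 2) (divr_gt0 e0 (ltr0Sn _ _)).
  exists del => // y yw; rewrite /g; case: eqVneq => [_|yw'].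
    by rewrite subrr nrm0.
  have yw0 : y - w != 0 by rewrite subr_eq0.
  have := H _ yw; rewrite subrKC.
  have -> : f y - f w - (y - w) * D = (y - w) * ((f y - f w) / (y - w) - D).
    by rewrite mulrBr mulrCA mulfV// mulr1.
  rewrite nrmM mulrC ler_pM2r ?nrm_gt0// => h; lra.
have Ig : square_int g r = 0.
  have := cre_le w; have := cim_le w => h1 h2.
  have k1 : `|cre w| < r by lra.
  have k2 : `|cim w| < r by lra.
  by apply: (@goursat_punctured _ _ w) => //; rewrite -ltr_norml.
have Eg : square_int g r = square_int (fun z => - f w * (z - w)^-1 + f z / (z - w)) r.
  apply: rect_int_ext => z /(lines_ge r0) rz; rewrite /g (negbTE (ge_neq wr rz)).
  by rewrite mulrBl mulNr addrC.
move: Eg; rewrite Ig square_int_lin//; last by move=> z rz; apply: holoM => //; exact: hi.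
by move=> /eqP; rewrite mulNr addrC eq_sym subr_eq0 => /eqP.
Qed.

(** Each step applies 1/(z - w) = 1/z + (w/z) / (z - w) to the remainder, which
    then carries the factor (w/z)^n, at most 2^-n on the sides when
    |w| <= r/2. *)
Lemma square_int_series f w M : (forall z, holo f z) -> nrm w <= r / 2 ->
  (forall z, E z -> nrm (f z) <= M) ->
  series (fun n => w ^+ n * square_int (fun z => f z * z^-1 ^+ n.+1) r) @ \oo -->
   f w * square_int (fun z => (z - w)^-1) r.
Proof.
move=> hf wr fM; have r0' := r0; have wr' : nrm w < r by lra.
rewrite -(cauchy_formula hf wr').
have nz z : r <= nrm z -> z != 0 by move=> rz; rewrite -nrm_gt0 (lt_le_trans r0).
have hV z : r <= nrm z -> holo (fun z => z^-1) z.
  by move=> /nz z0; apply: holoV => //; exact: holo_id.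
have hi z : r <= nrm z -> holo (fun z => (z - w)^-1) z.
  move=> rz; apply: holoV; first by rewrite subr_eq0 (ge_neq wr' rz).
  by apply: holoB; [exact: holo_id|exact: holo_cst].
pose rem n z := f z / (z - w) * (w * z^-1) ^+ n.
have hrem n z : r <= nrm z -> holo (rem n) z.
  move=> rz; apply: holoM; first by apply: holoM => //; exact: hi.
  by apply: holoX; apply: holoM; [exact: holo_cst|exact: hV].
have aux n : square_int (fun z => f z / (z - w)) r =
    series (fun n => w ^+ n * square_int (fun z => f z * z^-1 ^+ n.+1) r) n
    + square_int (rem n) r.
  elim: n => [|n IH].
    rewrite seriesEnat/= big_geq// add0r; congr (square_int _ r); apply/funext => z.
    by rewrite /rem expr0 mulr1.
  rewrite IH !seriesEnat/= big_nat_recr//= -addrA; congr (_ + _).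
  rewrite -square_int_lin.
  - apply: rect_int_ext => z /(lines_ge r0) rz; rewrite /rem !exprS exprMn.
    move: (w ^+ n) (z^-1 ^+ n) => U V.
    have := nz _ rz; have : z - w != 0 by rewrite subr_eq0 (ge_neq wr' rz).
    by move=> ? ?; field; apply/andP; split.
  - by move=> z rz; apply: holoM => //; apply: holoX; exact: hV.
  - exact: hrem.
have M0 : 0 <= M.
  apply: le_trans (nrm_ge0 (f (cpoint r r))) (fM _ _).
  by rewrite /on_edge cre_cpoint cim_cpoint !lexx !rr; split; [split|right; left].
apply: (@cvg_nrm_le _ _ _ (32 * M)) => n; rewrite nrmB [X in nrm (X - _)](aux n).
rewrite [X in nrm X](_ : _ = square_int (rem n) r); last by rewrite addrC addKr.
have -> : 32 * M / 2 ^+ n = 16 * (M / (r / 2) / 2 ^+ n) * r.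
  by field; rewrite expf_neq0//= lt0r_neq0.
apply: square_int_bound; first exact: hrem.
move=> z Ez; have /andP[rz _] := edge_ge r0 Ez.
rewrite /rem !(nrmM, nrmX, nrmV).
have h1 : (nrm (z - w))^-1 <= (r / 2)^-1.
  rewrite lef_pV2 ?posrE ?nrm_gt0 ?subr_eq0 ?(ge_neq wr' rz) ?divr_gt0//.
  by have := nrmD (z - w) w; rewrite subrK; lra.
have h2 : (nrm w * (nrm z)^-1) ^+ n <= (1 / 2) ^+ n.
  rewrite lerXn2r ?nnegrE ?mulr_ge0 ?invr_ge0 ?nrm_ge0//.
  by rewrite ler_pdivrMr ?(lt_le_trans r0)//; lra.
have -> : M / (r / 2) / 2 ^+ n = M * (r / 2)^-1 * (1 / 2) ^+ n.
  by rewrite expr_div_n expr1n mul1r.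
apply: ler_pM => //; rewrite ?mulr_ge0 ?exprn_ge0 ?invr_ge0 ?nrm_ge0//.
  by rewrite mulr_ge0 ?invr_ge0 ?nrm_ge0.
by apply: ler_pM => //; rewrite ?invr_ge0 ?nrm_ge0//; exact: fM.
Qed.

(** For the constant function 1 the expansion has a single nonzero term, since
    the higher powers of 1/z integrate to 0. *)
Lemma square_int_kernel w : nrm w <= r / 2 ->
  square_int (fun z => (z - w)^-1) r = square_int (fun z => z^-1) r.
Proof.
move=> wr.
have h := @square_int_series (fun _ => 1) w 1 (holo_cst 1) wr _.
have {}h := h (fun z _ => eq_ind_r (fun x => x <= 1) (lexx _) (nrm1 R)).
rewrite mul1r in h.
have E n : square_int (fun z => 1 * z^-1 ^+ n.+1) r =
    if n is 0%N then square_int (fun z => z^-1) r else 0.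
  have -> : (fun z => 1 * z^-1 ^+ n.+1) = (fun z : C => z^-1 ^+ n.+1).
    by apply/funext => z; rewrite mul1r.
  case: n => [|n]; last exact: square_int_invX.
  by congr (square_int _ r); apply/funext => z; rewrite expr1.
rewrite -(csum_unique h); apply: csum_unique.
apply: (@cvg_nrm_le _ _ _ (2 * nrm (square_int (fun z => z^-1) r))) => n.
case: n => [|n].
  rewrite seriesEnat/= big_geq// sub0r nrmN expr0 divr1.
  by have := nrm_ge0 (square_int (fun z => z^-1) r); lra.
rewrite series_recl E expr0 mul1r seriesEnat/= big1 ?addr0 ?subrr ?nrm0.
  by rewrite divr_ge0 ?mulr_ge0 ?nrm_ge0 ?exprn_ge0.
by move=> i _; rewrite E mulr0.
Qed.

Lemma cauchy_expansion f M : (forall z, holo f z) ->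
  (forall z, E z -> nrm (f z) <= M) ->
  exists c : nat -> C, (forall n, nrm (c n) <= 4 * M / r ^+ n) /\
    forall w, nrm w <= r / 2 -> series (fun n => c n * w ^+ n) @ \oo --> f w.
Proof.
move=> hf fM; pose kap := square_int (fun z => z^-1) r.
have k4 : 4 <= nrm kap by exact: square_int_inv.
have k0 : kap != 0 by rewrite -nrm_gt0; lra.
have nz z : r <= nrm z -> z != 0 by move=> rz; rewrite -nrm_gt0 (lt_le_trans r0).
exists (fun n => kap^-1 * square_int (fun z => f z * z^-1 ^+ n.+1) r); split.
  move=> n; rewrite nrmM nrmV.
  have h : nrm (square_int (fun z => f z * z^-1 ^+ n.+1) r) <= 16 * (M / r ^+ n.+1) * r.
    apply: square_int_bound.
      by move=> z /nz z0; apply: holoM => //; apply: holoX; apply: holoV => //; exact: holo_id.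
    move=> z Ez; have /andP[rz _] := edge_ge r0 Ez.
    rewrite nrmM nrmX nrmV -exprVn.
    apply: ler_pM; rewrite ?nrm_ge0 ?exprn_ge0 ?invr_ge0 ?nrm_ge0//.
      exact: fM.
    rewrite lerXn2r ?nnegrE ?invr_ge0 ?nrm_ge0 ?(ltW r0)//.
    by rewrite lef_pV2 ?posrE// (lt_le_trans r0).
  rewrite mulrC ler_pdivrMr; last by lra.
  apply: le_trans h _.
  have M0 : 0 <= M / r ^+ n.
    rewrite divr_ge0 ?exprn_ge0 ?(ltW r0)//.
    apply: le_trans (nrm_ge0 (f (cpoint r r))) (fM _ _).
    by rewrite /on_edge cre_cpoint cim_cpoint !lexx !rr; split; [split|right; left].
  have -> : 16 * (M / r ^+ n.+1) * r = 16 * (M / r ^+ n).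
    by rewrite exprS; field; rewrite expf_neq0 ?lt0r_neq0.
  have -> : 4 * M / r ^+ n * nrm kap = 4 * nrm kap * (M / r ^+ n) by ring.
  by rewrite ler_wpM2r//; lra.
move=> w wr.
have h := square_int_series hf wr fM; rewrite (square_int_kernel wr) in h.
have -> : (fun n => kap^-1 * square_int (fun z => f z * z^-1 ^+ n.+1) r * w ^+ n) =
  (fun n => kap^-1 * (w ^+ n * square_int (fun z => f z * z^-1 ^+ n.+1) r)).
  by apply/funext => n; rewrite -mulrA [X in _ * X]mulrC.
have -> : f w = kap^-1 * (f w * kap) by rewrite mulrCA (mulVf k0) mulr1.
exact: (@cvg_series_scale _ kap^-1 _ _ h).
Qed.

End Square.
End Cauchy.

(** * Everywhere convergent power series *)
Section Power.
Variable R : realType.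
Local Notation C := (Cplx R).
Implicit Types (z w h : C) (f g : C -> C) (c d : nat -> C) (r P : R).

(** The coefficient sequences of entire functions: infinite radius of
    convergence, phrased through Cauchy-type bounds. *)
Definition rapid c := forall r, 0 < r -> exists P, forall n, nrm (c n) <= P / r ^+ n.
Definition pseries c f := rapid c /\ forall z, series (fun n => c n * z ^+ n) @ \oo --> f z.

Lemma rapid_scaled c z s : rapid c -> nrm z <= s ->
  exists P, forall n, nrm (c n) * s ^+ n <= P / 2 ^+ n.
Proof.
move=> rc zs; have s0 : 0 <= s := le_trans (nrm_ge0 _) zs.
have r0 : 0 < 2 * (s + 1) by lra.
have [P HP] := rc _ r0; exists P => n.
have P0 : 0 <= P.
  by have := HP 0%N; rewrite expr0 divr1; apply: le_trans; exact: nrm_ge0.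
apply: (@le_trans _ _ (P / (2 * (s + 1)) ^+ n * (s + 1) ^+ n)).
  apply: ler_pM; rewrite ?nrm_ge0 ?exprn_ge0//.
  by rewrite lerXn2r ?nnegrE//; lra.
rewrite exprMn invfM -!mulrA mulVf ?mulr1// expf_neq0// lt0r_neq0//; lra.
Qed.

Lemma rapid_term c z : rapid c -> exists P, forall n, nrm (c n * z ^+ n) <= P / 2 ^+ n.
Proof.
by move=> rc; have [P HP] := rapid_scaled rc (lexx (nrm z)); exists P => n;
  rewrite nrmM nrmX.
Qed.

Definition deriv_coef c := fun n => n.+1%:R * c n.+1.

Lemma rapid_deriv_coef c : rapid c -> rapid (deriv_coef c).
Proof.
move=> rc r r0; have r20 : 0 < 2 * r by lra.
have [P HP] := rc _ r20; exists (P / (2 * r)) => n.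
have P0 : 0 <= P.
  by have := HP 0%N; rewrite expr0 divr1; apply: le_trans; exact: nrm_ge0.
rewrite nrmM nrm_nat; apply: (@le_trans _ _ (2 ^+ n * (P / (2 * r) ^+ n.+1))).
  apply: ler_pM; rewrite ?nrm_ge0// -natrX ler_nat; exact: ltn_expl.
have r1 : r != 0 by rewrite lt0r_neq0.
rewrite exprS exprMn le_eqVlt; apply/orP; left; apply/eqP; field.
by rewrite r1 !expf_neq0.
Qed.

Lemma nat_pow_bound (x : R) n : 0 <= x -> n%:R * x ^+ n.-1 <= (x + 2) ^+ n.
Proof.
move=> x0; elim: n => [|n IH]; first by rewrite mul0r expr0.
rewrite /= exprS -natr1 mulrDl mul1r.
have e1 : n%:R * x ^+ n <= x * (x + 2) ^+ n.
  case: n IH => [|n] IH; first by rewrite mul0r expr0 mulr1.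
  by rewrite [X in _ * X]exprS mulrCA ler_wpM2l.
have e2 : x ^+ n <= (x + 2) ^+ n.
  by rewrite lerXn2r ?nnegrE//; lra.
have e3 : 0 <= (x + 2) ^+ n by rewrite exprn_ge0//; lra.
by lra.
Qed.

(** The second-order remainder of (z + h)^n. *)
Definition expr_rest z h n : C := (z + h) ^+ n - z ^+ n - n%:R * z ^+ n.-1 * h.

Lemma expr_restS z h n :
  expr_rest z h n.+1 = (z + h) * expr_rest z h n + n%:R * z ^+ n.-1 * (h * h).
Proof.
rewrite /expr_rest /= !exprS; case: n => [|n]; first by rewrite !expr0 /=; ring.
by rewrite /= !exprS -[n.+2%:R]natr1; ring.
Qed.

(** The factor |h|^2 is uniform in n up to a geometric factor, which rapidly
    decaying coefficients absorb: hence termwise differentiation. *)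
Lemma expr_rest_bound z h n : nrm h <= 1 ->
  nrm (expr_rest z h n) <= nrm h * nrm h * (nrm z + 2) ^+ n.
Proof.
move=> h1; have z0 := nrm_ge0 z; have h0 := nrm_ge0 h.
elim: n => [|n IH].
  by rewrite /expr_rest !expr0 subrr mul0r mul0r subr0 nrm0 mulr1 mulr_ge0.
have nx := nat_pow_bound n z0.
rewrite expr_restS; apply: le_trans (nrmD _ _) _.
rewrite !nrmM nrm_nat nrmX exprS.
have b1 : nrm (z + h) * nrm (expr_rest z h n) <=
    (nrm z + 1) * (nrm h * nrm h * (nrm z + 2) ^+ n).
  apply: ler_pM; rewrite ?nrm_ge0//.
  by apply: le_trans (nrmD _ _) _; lra.
have b2 : n%:R * nrm z ^+ n.-1 * (nrm h * nrm h) <= (nrm z + 2) ^+ n * (nrm h * nrm h).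
  by rewrite ler_wpM2r ?mulr_ge0.
apply: le_trans (lerD b1 b2) _.
by rewrite le_eqVlt; apply/orP; left; apply/eqP; ring.
Qed.

Lemma pseries_cderive c f z : pseries c f ->
  cderive f z (csum (fun n => deriv_coef c n * z ^+ n)).
Proof.
move=> [rc fc] e e0.
have s0 : nrm z <= nrm z + 2 by lra.
have [P HP] := rapid_scaled rc s0.
have P0 : 0 <= P.
  have := HP 0%N; rewrite expr0 divr1; apply: le_trans.
  by rewrite mulr_ge0 ?nrm_ge0.
have [Q HQ] := rapid_term z (rapid_deriv_coef rc).
have P1 : 0 < 2 * P + 1 by lra.
exists (Num.min 1 (e / (2 * P + 1))); first by rewrite lt_min ltr01 divr_gt0.
move=> h; rewrite lt_min => /andP[h1 h2].
have S1 := fc (z + h); have S0 := fc z; have S2 := csum_cvg HQ.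
have S3 : series (fun n => n%:R * c n * z ^+ n.-1 * h) @ \oo -->
    h * csum (fun n => deriv_coef c n * z ^+ n).
  apply/cvg_series_shift; rewrite !mul0r subr0.
  have := @cvg_series_scale _ h _ _ S2.
  by have -> : (fun n => h * (deriv_coef c n * z ^+ n)) =
      (fun n => n.+1%:R * c n.+1 * z ^+ n.+1.-1 * h)
    by apply/funext => n; rewrite /deriv_coef mulrC.
have S : series (fun n => c n * expr_rest z h n) @ \oo -->
    f (z + h) - f z - h * csum (fun n => deriv_coef c n * z ^+ n).
  have A1 := @cvg_series_lin _ (-1) _ _ _ _ S0 S1.
  have A2 := @cvg_series_lin _ (-1) _ _ _ _ S3 A1.
  move: A2.
  have -> : (fun n => -1 * (n%:R * c n * z ^+ n.-1 * h) +
      (-1 * (c n * z ^+ n) + c n * (z + h) ^+ n))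
    = (fun n => c n * expr_rest z h n) by apply/funext => n; rewrite /expr_rest; ring.
  have -> // : -1 * (h * csum (fun n => deriv_coef c n * z ^+ n)) + (-1 * f z + f (z + h)) =
    f (z + h) - f z - h * csum (fun n => deriv_coef c n * z ^+ n) by ring.
rewrite -(csum_unique S).
have B n : nrm (c n * expr_rest z h n) <= nrm h * nrm h * P / 2 ^+ n.
  rewrite nrmM; apply: le_trans (ler_wpM2l (nrm_ge0 _) (expr_rest_bound _ _ (ltW h1))) _.
  rewrite mulrCA -[leRHS]mulrA; apply: ler_wpM2l; first by rewrite mulr_ge0 ?nrm_ge0.
  exact: HP.
apply: le_trans (csum_le B) _.
have -> : 2 * (nrm h * nrm h * P) = 2 * P * nrm h * nrm h by ring.
apply: ler_wpM2r; first exact: nrm_ge0.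
move: h2; rewrite ltr_pdivlMr// => h2.
have := nrm_ge0 h; nra.
Qed.

Lemma pseries_derive1 c f : pseries c f -> pseries (deriv_coef c) (derive1 f).
Proof.
move=> PSf; have [rc _] := PSf; split; first exact: rapid_deriv_coef.
move=> z; rewrite (cderive_derive1 (pseries_cderive z PSf)).
by have [P HP] := rapid_term z (rapid_deriv_coef rc); exact: csum_cvg HP.
Qed.

Lemma pseries_derive1n c f k : pseries c f -> pseries (iter k deriv_coef c) (derive1n k f).
Proof. by move=> h; elim: k => [//|k IH]; rewrite derive1nS iterS; exact: pseries_derive1. Qed.

Lemma iter_deriv_coef c k n : iter k deriv_coef c n = ((n + k) ^_ k)%:R * c (n + k)%N.
Proof.
elim: k n => [|k IH] n; first by rewrite ffactn0 mul1r addn0.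
rewrite iterS /deriv_coef IH mulrA -natrM addSnnS ffactnSr; congr (_%:R * _).
by rewrite mulnC addnS subSn ?leq_addl// addnK.
Qed.

Lemma pseries_taylor c f k : pseries c f -> derive1n k f 0 = k`!%:R * c k.
Proof.
move=> /(pseries_derive1n k)[_ /(_ 0)] h.
rewrite -(csum_unique h); apply: csum_unique.
apply/cvg_series_shift; rewrite iter_deriv_coef ffactnn expr0 mulr1 subrr.
have -> : (fun n => iter k deriv_coef c n.+1 * 0 ^+ n.+1) = (fun _ => 0).
  by apply/funext => n; rewrite exprS mul0r mulr0.
exact: cvg_series0.
Qed.

(** For small t = |w| the tail of the series is O(t), so |d_0| = O(t). *)
Lemma pseries_unique_head d P r : 0 < r -> (forall n, nrm (d n) <= P / r ^+ n) ->
  (forall w, 0 < nrm w <= r / 2 -> series (fun n => d n * w ^+ n) @ \oo --> (0 : C)) ->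
  d 0%N = 0.
Proof.
move=> r0 dP d0.
have P0 : 0 <= P.
  by have := dP 0%N; rewrite expr0 divr1; apply: le_trans; exact: nrm_ge0.
have aux (t : R) : 0 < t -> t <= r / 2 -> nrm (d 0%N) <= 2 * (P / r * t).
  move=> t0 tr.
  have nt : nrm (ofR t) = t by rewrite nrm_ofR ger0_norm// ltW.
  have /d0/cvg_series_shift : 0 < nrm (ofR t) <= r / 2 by rewrite nt t0.
  rewrite sub0r expr0 mulr1 => /csum_unique h.
  rewrite -nrmN -h; apply: csum_le => n.
  rewrite nrmM nrmX nt.
  apply: (@le_trans _ _ (P / r ^+ n.+1 * (t * (r / 2) ^+ n))).
    apply: ler_pM; rewrite ?nrm_ge0 ?exprn_ge0 ?(ltW t0)//.
    rewrite exprS ler_wpM2l ?(ltW t0)// lerXn2r ?nnegrE ?(ltW t0)// divr_ge0 ?(ltW r0)//.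
  rewrite exprS expr_div_n le_eqVlt; apply/orP; left; apply/eqP; field.
  by rewrite !expf_neq0 ?lt0r_neq0.
apply/eqP; rewrite -nrm_eq0 -[_ == 0]negbK; apply/negP => n0.
have {}n0 : 0 < nrm (d 0%N) by rewrite lt_neqAle eq_sym n0 nrm_ge0.
set x := nrm _ in aux n0.
pose t := Num.min (r / 2) (x / (4 * (P / r + 1))).
have Q0 : 0 <= P / r by rewrite divr_ge0 ?(ltW r0).
have Q1 : 0 < 4 * (P / r + 1) by lra.
have t0 : 0 < t by rewrite lt_min !divr_gt0.
have := aux t t0; rewrite /t ge_min lexx => /(_ isT).
have : t <= x / (4 * (P / r + 1)) by rewrite ge_min lexx orbT.
rewrite -/t ler_pdivlMr// => h1 h2.
move: h1 h2 Q0 t0 n0; move: (P / r) => q h1 h2 Q0 t0 n0.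
nra.
Qed.

(** Dividing the vanishing series by w shifts the coefficients; this is why the
    hypothesis leaves out the point w = 0. *)
Lemma pseries_unique d P r : 0 < r -> (forall n, nrm (d n) <= P / r ^+ n) ->
  (forall w, 0 < nrm w <= r / 2 -> series (fun n => d n * w ^+ n) @ \oo --> (0 : C)) ->
  forall n, d n = 0.
Proof.
move=> r0 + + n; elim: n d P => [|n IH] d P dP d0; first exact: pseries_unique_head d0.
have h0 : d 0%N = 0 by exact: pseries_unique_head d0.
apply: (IH (fun n => d n.+1) (P / r)).
  by move=> k; apply: le_trans (dP k.+1) _; rewrite exprS invfM mulrA.
move=> w wr; have /cvg_series_shift := d0 w wr.
rewrite h0 mul0r subr0 => /(@cvg_series_scale _ w^-1); rewrite mulr0.
have w0 : w != 0 by rewrite -nrm_gt0; case/andP: wr.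
have -> // : (fun n => w^-1 * (d n.+1 * w ^+ n.+1)) = (fun n => d n.+1 * w ^+ n).
by apply/funext => k; rewrite exprS mulrCA (mulKf w0).
Qed.

(** Each square gives an expansion near 0 with its own coefficients; uniqueness
    identifies them all, so the bounds and the domains of all squares apply to
    one sequence. *)
Lemma holo_pseries f : (forall z, holo f z) -> exists c, pseries c f /\
  forall r M, 0 < r -> (forall z, on_edge (- r) r (- r) r z -> nrm (f z) <= M) ->
  forall n, nrm (c n) <= 4 * M / r ^+ n.
Proof.
move=> hf.
have bdd r : 0 < r -> exists M, forall z, on_edge (- r) r (- r) r z -> nrm (f z) <= M.
  move=> r0; apply: edge_bounded; try by lra.
  by apply: edge_cont_lines => z _; exact: holo_continuous.
have [M1 H1] := bdd _ ltr01.
have [c [cM cf]] := cauchy_expansion ltr01 hf H1.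
have main r M : 0 < r -> (forall z, on_edge (- r) r (- r) r z -> nrm (f z) <= M) ->
    (forall n, nrm (c n) <= 4 * M / r ^+ n) /\
    forall w, nrm w <= r / 2 -> series (fun n => c n * w ^+ n) @ \oo --> f w.
  move=> r0 HM; have [c' [cM' cf']] := cauchy_expansion r0 hf HM.
  suff -> : c = c' by [].
  apply/funext => n; apply/eqP; rewrite -subr_eq0; apply/eqP; move: n.
  pose s := Num.min 1 r.
  have s0 : 0 < s by rewrite lt_min ltr01.
  have s1 : s <= 1 by rewrite ge_min lexx.
  have sr : s <= r by rewrite ge_min lexx orbT.
  have sV (t K : R) n : 0 <= K -> s <= t -> K / t ^+ n <= K / s ^+ n.
    move=> K0 st; rewrite ler_wpM2l// lef_pV2 ?posrE ?exprn_gt0 ?(lt_le_trans s0)//.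
    by rewrite lerXn2r ?nnegrE ?(ltW s0)// (le_trans (ltW s0)).
  have K0 : 0 <= 4 * M1.
    by have := cM 0%N; rewrite expr0 divr1; apply: le_trans; exact: nrm_ge0.
  have K1 : 0 <= 4 * M.
    by have := cM' 0%N; rewrite expr0 divr1; apply: le_trans; exact: nrm_ge0.
  apply: (@pseries_unique (fun n => c n - c' n) (4 * M1 + 4 * M) s s0).
    move=> n; apply: le_trans (nrmD _ _) _; rewrite nrmN mulrDl; apply: lerD.
      exact: le_trans (cM n) (sV _ _ n K0 s1).
    exact: le_trans (cM' n) (sV _ _ n K1 sr).
  move=> w /andP[_ ws].
  have w1 : nrm w <= 1 / 2 by lra.
  have w2 : nrm w <= r / 2 by lra.
  have := @cvg_series_lin _ (-1) _ _ _ _ (cf' _ w2) (cf _ w1).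
  rewrite mulN1r addNr.
  have -> // : (fun n => -1 * (c' n * w ^+ n) + c n * w ^+ n) =
    (fun n => (c n - c' n) * w ^+ n).
  by apply/funext => n; ring.
exists c; split; last by move=> r M r0 HM; have [] := main r M r0 HM.
split.
  by move=> r r0; have [M HM] := bdd r r0; exists (4 * M); have [] := main r M r0 HM.
move=> z; have r0 : 0 < 2 * nrm z + 1 by have := nrm_ge0 z; lra.
have [M HM] := bdd _ r0; have [_] := main _ M r0 HM; apply; lra.
Qed.

Lemma pseries_holo c f z : pseries c f -> holo f z.
Proof. by move=> h; eexists; exact: pseries_cderive h. Qed.

End Power.

(** * The operator phi(D) on Taylor coefficients *)
Section Entire.
Variable R : realType.
Local Notation C := (Cplx R).
Implicit Types (z w h : C) (f g phi : entire_fun R) (c d p : nat -> C) (r P : R).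

Lemma entire_holo f z : holo (\val f) z.
Proof.
by apply/derivable_cderiveP; have /entireP := valP f; apply.
Qed.

Lemma pseries_entire c (g : C -> C) : pseries c g -> g \in @entire R.
Proof.
by move=> h; apply/entireP => z; apply/derivable_cderiveP; exact: pseries_holo h.
Qed.

Lemma pseries_taylor_coef c f : pseries c (\val f) -> taylor_coef f = c.
Proof.
move=> h; apply/funext => k; rewrite /taylor_coef (pseries_taylor k h) mulrC mulKf//.
Qed.

Lemma entire_pseries f : pseries (taylor_coef f) (\val f).
Proof.
by have [c [h _]] := holo_pseries (entire_holo f); rewrite (pseries_taylor_coef h).
Qed.

Lemma cauchy_estimate f r M : 0 < r ->
  (forall z, on_edge (- r) r (- r) r z -> nrm (\val f z) <= M) ->
  forall n, nrm (taylor_coef f n) <= 4 * M / r ^+ n.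
Proof.
have [c [h H]] := holo_pseries (entire_holo f).
by rewrite (pseries_taylor_coef h); exact: H.
Qed.

Lemma fact_le_exp k : (k`! <= k.+1 ^ k)%N.
Proof.
elim: k => [//|k IH]; rewrite factS expnS; apply: leq_mul => //.
by apply: leq_trans IH _; case: k => [//|k]; rewrite leq_exp2r.
Qed.

(** The Cauchy estimate on the square of half-side k + 1 bounds p_k by a
    constant times e^(2|B|(k+1)) / (k+1)^k, and k! <= (k+1)^k. *)
Lemma exponential_coef phi : exponential_type phi ->
  exists A B, [/\ 0 <= A, 0 < B & forall k, nrm (taylor_coef phi k) <= A * B ^+ k / k`!%:R].
Proof.
move=> [A [B H]].
have HA z : nrm (\val phi z) <= A * expR (B * nrm z).
  by have := H z; rewrite nrmE -/(ofR _) ofR_le.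
have A0 : 0 <= A.
  by have := HA 0; rewrite nrm0 mulr0 expR0 mulr1; apply: le_trans; exact: nrm_ge0.
pose b := expR (`|B| * 2).
exists (4 * A * b), b; split; [by rewrite !mulr_ge0 ?expR_ge0|exact: expR_gt0|].
move=> k; have r0 : 0 < k.+1%:R :> R by rewrite ltr0n.
have := @cauchy_estimate phi k.+1%:R (A * b ^+ k.+1) r0 _ k.
have hE z : on_edge (- k.+1%:R) k.+1%:R (- k.+1%:R) k.+1%:R z ->
    nrm (\val phi z) <= A * b ^+ k.+1.
  move=> Ez; have /andP[_ z2] := edge_ge r0 Ez.
  apply: le_trans (HA z) _; apply: ler_wpM2l => //.
  rewrite /b -expRM_natr ler_expR.
  apply: (@le_trans _ _ (`|B| * nrm z)); first by rewrite ler_wpM2r ?nrm_ge0// ler_norm.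
  by rewrite -mulrA ler_wpM2l.
move=> /(_ hE) h; apply: le_trans h _.
have -> : 4 * (A * b ^+ k.+1) = 4 * A * b * b ^+ k by rewrite exprS; ring.
rewrite ler_wpM2l//.
  by rewrite !mulr_ge0 ?exprn_ge0 ?expR_ge0.
by rewrite lef_pV2 ?posrE ?exprn_gt0 ?ltr0n ?fact_gt0// -natrX ler_nat fact_le_exp.
Qed.

Definition coef_exp p := exists A B : R,
  [/\ 0 <= A, 0 < B & forall k, nrm (p k) <= A * B ^+ k / k`!%:R].

Lemma bin_le n k : ('C(n + k, k) <= 2 ^ (n + k))%N.
Proof.
have := @expnDn 1 1 (n + k); rewrite addn1 => ->.
have hk : (k < (n + k).+1)%N by rewrite ltnS leq_addl.
by rewrite (bigD1 (Ordinal hk))//= !exp1n !muln1 leq_addr.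
Qed.

(** The falling factorial is k! times a binomial coefficient, which is at most
    2^(n+k); the k! cancels against that of p_k. As c decays like r^-(n+k) with
    r = 8 (B + s), what is left is at most (2/8)^(n+k). *)
Lemma diff_op_term_bound p c s : coef_exp p -> rapid c -> 0 < s ->
  exists Q : R, 0 <= Q /\ forall n k,
    nrm (p k * iter k (@deriv_coef R) c n) * s ^+ n <= Q / 4 ^+ (n + k).
Proof.
move=> [A [B [A0 B0 pB]]] rc s0.
have r0 : 0 < 8 * (B + s) by lra.
have [P HP] := rc _ r0.
have P0 : 0 <= P.
  by have := HP 0%N; rewrite expr0 divr1; apply: le_trans; exact: nrm_ge0.
exists (A * P); split; first exact: mulr_ge0.
move=> n k; rewrite iter_deriv_coef !nrmM nrm_nat.
have kf : (k`!%:R : R) != 0 by rewrite pnatr_eq0 -lt0n fact_gt0.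
apply: (@le_trans _ _ (A * B ^+ k / k`!%:R *
  ((2 ^+ (n + k) * k`!%:R) * (P / (8 * (B + s)) ^+ (n + k))) * s ^+ n)).
  apply: ler_wpM2r; first by rewrite exprn_ge0// ltW.
  apply: ler_pM; rewrite ?nrm_ge0 ?mulr_ge0 ?nrm_ge0//.
  apply: ler_pM; rewrite ?nrm_ge0//.
  by rewrite -natrX -natrM ler_nat -bin_ffact leq_mul// bin_le.
have bs : B + s != 0 by rewrite lt0r_neq0// addr_gt0.
have -> : A * B ^+ k / k`!%:R *
    ((2 ^+ (n + k) * k`!%:R) * (P / (8 * (B + s)) ^+ (n + k))) * s ^+ n
   = A * P * (B ^+ k * s ^+ n / (B + s) ^+ (n + k)) * (2 ^+ (n + k) / 8 ^+ (n + k)).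
  rewrite exprMn; field; rewrite ?kf ?expf_neq0//.
have -> : (2 : R) ^+ (n + k) / 8 ^+ (n + k) = (4 ^+ (n + k))^-1.
  by rewrite -expr_div_n -exprVn; congr (_ ^+ _); field.
rewrite ler_wpM2r ?invr_ge0 ?exprn_ge0//.
rewrite -[leRHS]mulr1; apply: ler_wpM2l; first exact: mulr_ge0.
rewrite ler_pdivrMr ?exprn_gt0 ?addr_gt0// mul1r exprD mulrC.
by apply: ler_pM; rewrite ?exprn_ge0 ?(ltW s0) ?(ltW B0)//
  lerXn2r ?nnegrE ?addr_ge0 ?(ltW s0) ?(ltW B0)//; lra.
Qed.

(** Taylor coefficients at 0 of sum p_k f^(k) when f has coefficients c. *)
Definition diff_op_coef p c n := csum (fun k => p k * iter k (@deriv_coef R) c n).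

Lemma pow4_le (Q : R) n k : 0 <= Q -> Q / 4 ^+ (n + k) <= Q / 2 ^+ n / 2 ^+ k.
Proof.
move=> Q0; rewrite -mulrA -invfM -exprD ler_wpM2l// lef_pV2 ?posrE ?exprn_gt0//.
by rewrite lerXn2r ?nnegrE//; lra.
Qed.

Lemma diff_op_coef_term p c n : coef_exp p -> rapid c ->
  exists P, forall k, nrm (p k * iter k (@deriv_coef R) c n) <= P / 2 ^+ k.
Proof.
move=> pE rc; have [Q [Q0 HQ]] := diff_op_term_bound pE rc ltr01.
exists (Q / 2 ^+ n) => k; have := HQ n k; rewrite expr1n mulr1 => h.
exact: le_trans h (pow4_le _ _ Q0).
Qed.

Lemma rapid_diff_op_coef p c : coef_exp p -> rapid c -> rapid (diff_op_coef p c).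
Proof.
move=> pE rc r r0; have [Q [Q0 HQ]] := diff_op_term_bound pE rc r0.
exists (2 * Q) => n; rewrite -mulrA; apply: csum_le => k.
rewrite mulrAC -(ler_pM2r (exprn_gt0 n r0)) divfK ?expf_neq0 ?lt0r_neq0//.
apply: le_trans (HQ n k) _; rewrite ler_wpM2l// lef_pV2 ?posrE ?exprn_gt0//.
rewrite exprD (@le_trans _ _ (4 ^+ k))//.
  by rewrite lerXn2r ?nnegrE//; lra.
by rewrite ler_peMl ?exprn_ge0// exprn_ege1//; lra.
Qed.

Lemma csum_scale k (u : nat -> C) : cvgn (series u) -> csum (fun n => k * u n) = k * csum u.
Proof. by move=> h; apply: csum_unique; apply: cvg_series_scale. Qed.

Lemma diag_sym (a : nat -> nat -> C) m :
  \sum_(n < m.+1) a n (m - n)%N = \sum_(n < m.+1) a (m - n)%N n.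
Proof.
rewrite (reindex_inj rev_ord_inj)/=; apply: eq_bigr => n _.
by rewrite subSS subKn// -ltnS.
Qed.

Lemma csum_swap (a : nat -> nat -> C) P : (forall n k, nrm (a n k) <= P / 4 ^+ (n + k)) ->
  csum (fun n => csum (a n)) = csum (fun k => csum (fun n => a n k)).
Proof.
move=> aP; rewrite -(csum_unique (csum_diag aP)).
have aP' n k : nrm (a k n) <= P / 4 ^+ (n + k) by rewrite addnC.
rewrite -(csum_unique (csum_diag aP')); congr csum.
by apply/funext => m; rewrite diag_sym.
Qed.

(** The k-th derivative of f is a power series in z; exchanging the sum over k
    with the sum over the powers of z collects the coefficients. *)
Lemma diff_op_series p c (f : C -> C) z : coef_exp p -> pseries c f ->
  csum (fun k => p k * derive1n k f z) = csum (fun n => diff_op_coef p c n * z ^+ n).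
Proof.
move=> pE PSf; have [rc _] := PSf.
have s0 : 0 < nrm z + 1 by have := nrm_ge0 z; lra.
have [Q [Q0 HQ]] := diff_op_term_bound pE rc s0.
have aQ n k : nrm (p k * iter k (@deriv_coef R) c n * z ^+ n) <= Q / 4 ^+ (n + k).
  apply: le_trans (HQ n k); rewrite nrmM nrmX ler_wpM2l ?nrm_ge0//.
  by rewrite lerXn2r ?nnegrE ?nrm_ge0 ?(ltW s0)//; lra.
have cvd n : cvgn (series (fun k => p k * iter k (@deriv_coef R) c n)).
  by have [P HP] := diff_op_coef_term n pE rc; apply/cvg_ex; eexists; exact: csum_cvg HP.
have := csum_swap aQ.
have -> : (fun n => csum (fun k => p k * iter k (@deriv_coef R) c n * z ^+ n)) =
    (fun n => diff_op_coef p c n * z ^+ n).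
  apply/funext => n; rewrite mulrC -(csum_scale _ (cvd n)); congr csum.
  by apply/funext => k; rewrite mulrC.
move=> ->; congr csum; apply/funext => k.
have [_ /(_ z) h] := pseries_derive1n k PSf.
rewrite -(csum_unique h) -csum_scale; last by apply/cvg_ex; eexists; exact: h.
by congr csum; apply/funext => n; rewrite mulrA.
Qed.

(** The rearranged series has rapidly decaying coefficients, so the pointwise
    limit that defines [diff_op] is an entire function. *)
Lemma pseries_diff_op phi f : exponential_type phi ->
  pseries (diff_op_coef (taylor_coef phi) (taylor_coef f)) (\val (diff_op phi f)).
Proof.
move=> /exponential_coef pE; have PSf := entire_pseries f.
have rd := rapid_diff_op_coef pE PSf.1.
have E : pseries (diff_op_coef (taylor_coef phi) (taylor_coef f))
    (fun z => limn (series (fun k => taylor_coef phi k * derive1n k (\val f) z))).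
  split=> // z; rewrite -/(csum _) (diff_op_series z pE PSf).
  by have [P HP] := rapid_term z rd; exact: csum_cvg HP.
by rewrite /diff_op insubdK//; exact: pseries_entire E.
Qed.

Lemma pseries_dilation (lambda : C) c f : nrm lambda <= 1 -> pseries c (\val f) ->
  pseries (fun n => lambda ^+ n * c n) (\val (dilation lambda f)).
Proof.
move=> l1 [rc h]; split.
  move=> r r0; have [P HP] := rc r r0; exists P => n.
  rewrite nrmM nrmX; apply: le_trans (HP n).
  by rewrite ler_piMl ?nrm_ge0// exprn_ile1 ?nrm_ge0.
move=> z; have := h (lambda * z).
have -> // : (fun n => c n * (lambda * z) ^+ n) = (fun n => lambda ^+ n * c n * z ^+ n).
by apply/funext => n; rewrite exprMn; ring.
Qed.

Lemma taylor_dilation_diff_op (lambda : C) phi f n : nrm lambda <= 1 -> exponential_type phi ->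
  taylor_coef (dilation lambda (diff_op phi f)) n =
  lambda ^+ n * diff_op_coef (taylor_coef phi) (taylor_coef f) n.
Proof.
by move=> l1 pE; rewrite (pseries_taylor_coef (pseries_dilation l1 (pseries_diff_op f pE))).
Qed.

Lemma taylor_lin (k : C) f g n :
  taylor_coef (k *: f + g) n = k * taylor_coef f n + taylor_coef g n.
Proof.
suff h : pseries (fun n => k * taylor_coef f n + taylor_coef g n) (\val (k *: f + g)).
  by rewrite (pseries_taylor_coef h).
have [rf hf] := entire_pseries f; have [rg hg] := entire_pseries g; split.
  move=> r r0; have [P HP] := rf r r0; have [Q HQ] := rg r r0.
  exists (nrm k * P + Q) => i; apply: le_trans (nrmD _ _) _.
  by rewrite mulrDl nrmM -mulrA; apply: lerD => //; rewrite ler_wpM2l ?nrm_ge0.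
move=> z; have := @cvg_series_lin _ k _ _ _ _ (hf z) (hg z).
have -> // : (fun n => k * (taylor_coef f n * z ^+ n) + taylor_coef g n * z ^+ n) =
  (fun n => (k * taylor_coef f n + taylor_coef g n) * z ^+ n).
by apply/funext => i; ring.
Qed.

(** * Eigenfunctionals given by weights *)

(** G is the coefficient sequence of an entire function of exponential type. *)
Definition weight (G : nat -> C) := exists K M : R,
  [/\ 0 <= K, 0 < M & forall n, nrm (G n) * n`!%:R <= K * M ^+ n].

(** The functional with value sum G_n a^n on z |-> exp (a z): as n! times the
    n-th Taylor coefficient is f^(n)(0), it is f |-> sum G_n f^(n)(0). *)
Definition pairing (G : nat -> C) f := csum (fun n => G n * n`!%:R * taylor_coef f n).

Lemma pairing_term G : weight G -> exists r K : R, [/\ 0 < r, 0 <= K &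
  forall f M, (forall z, on_edge (- r) r (- r) r z -> nrm (\val f z) <= M) ->
   forall n, nrm (G n * n`!%:R * taylor_coef f n) <= (K * M) / 2 ^+ n].
Proof.
move=> [K [M [K0 M0 HG]]]; have r0 : 0 < 2 * M by lra.
exists (2 * M), (4 * K); split => //; first by rewrite mulr_ge0.
move=> f Mb fM n; have h := cauchy_estimate r0 fM n.
rewrite nrmM [X in X * _]nrmM nrm_nat.
apply: (@le_trans _ _ (K * M ^+ n * (4 * Mb / (2 * M) ^+ n))).
  by apply: ler_pM; rewrite ?mulr_ge0 ?nrm_ge0.
rewrite exprMn le_eqVlt; apply/orP; left; apply/eqP; field.
by rewrite !expf_neq0 ?lt0r_neq0.
Qed.

Lemma entire_edge_bounded f r : 0 < r ->
  exists M, forall z, on_edge (- r) r (- r) r z -> nrm (\val f z) <= M.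
Proof.
move=> r0; apply: edge_bounded; try by lra.
by apply: edge_cont_lines => z _; exact/holo_continuous/entire_holo.
Qed.

Lemma pairing_cvg G f : weight G ->
  series (fun n => G n * n`!%:R * taylor_coef f n) @ \oo --> pairing G f.
Proof.
move=> wG; have [r [K [r0 _ H]]] := pairing_term wG.
have [M HM] := entire_edge_bounded f r0.
exact: csum_cvg (H f M HM).
Qed.

(** Continuity for the compact-open topology: the modulus on the sides of one
    square controls the functional. *)
Lemma pairing_bound G : weight G -> exists r K : R, [/\ 0 < r, 0 <= K &
  forall f M, (forall z, on_edge (- r) r (- r) r z -> nrm (\val f z) <= M) ->
   nrm (pairing G f) <= K * M].
Proof.
move=> wG; have [r [K [r0 K0 H]]] := pairing_term wG; exists r, (2 * K); split => //.
  by rewrite mulr_ge0.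
by move=> f M HM; rewrite -mulrA; exact: csum_le (H f M HM).
Qed.

Lemma pairing_lin G k f g : weight G -> pairing G (k *: f + g) = k * pairing G f + pairing G g.
Proof.
move=> wG; apply: csum_unique.
have := @cvg_series_lin _ k _ _ _ _ (@pairing_cvg G f wG) (@pairing_cvg G g wG).
have -> // : (fun n => k * (G n * n`!%:R * taylor_coef f n) + G n * n`!%:R * taylor_coef g n) =
  (fun n => G n * n`!%:R * taylor_coef (k *: f + g) n).
by apply/funext => n; rewrite taylor_lin; ring.
Qed.

(** The hypothesis is the identity phi(a) G(lambda a) = mu G(a) of power series.
    In the double sum for the left-hand side the terms with n + k = m share
    the factor m! c_m, and on this diagonal the hypothesis applies. *)
Lemma pairing_eigen G (lambda mu : C) phi f :
  weight G -> nrm lambda <= 1 -> exponential_type phi ->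
  (forall m, \sum_(n < m.+1) G n * lambda ^+ n * taylor_coef phi (m - n) = mu * G m) ->
  pairing G (dilation lambda (diff_op phi f)) = mu * pairing G f.
Proof.
move=> wG l1 pT HG; have pE := exponential_coef pT; have [rc _] := entire_pseries f.
set p := taylor_coef phi in HG pE *; set c := taylor_coef f in rc *.
have [K [M [K0 M0 HK]]] := wG.
have [Q [Q0 HQ]] := diff_op_term_bound pE rc M0.
pose a n k := G n * n`!%:R * lambda ^+ n * (p k * iter k (@deriv_coef R) c n).
have aQ n k : nrm (a n k) <= (K * Q) / 4 ^+ (n + k).
  rewrite /a nrmM; apply: (@le_trans _ _ (K * M ^+ n * nrm (p k * iter k (@deriv_coef R) c n))).
    rewrite ler_wpM2r ?nrm_ge0// !nrmM nrm_nat nrmX -[leRHS]mulr1.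
    apply: ler_pM => //; rewrite ?mulr_ge0 ?nrm_ge0 ?exprn_ge0 ?nrm_ge0//.
    by rewrite exprn_ile1 ?nrm_ge0.
  by rewrite -mulrA -[leRHS]mulrA ler_wpM2l// mulrC HQ.
have cvd n : cvgn (series (fun k => p k * iter k (@deriv_coef R) c n)).
  by have [P HP] := diff_op_coef_term n pE rc; apply/cvg_ex; eexists; exact: csum_cvg HP.
have E1 : csum (fun n => csum (a n)) = pairing G (dilation lambda (diff_op phi f)).
  congr csum; apply/funext => n; rewrite /a (csum_scale _ (cvd n)) taylor_dilation_diff_op//.
  by rewrite -/p -/c -/(diff_op_coef p c n); ring.
rewrite -E1 -(csum_unique (csum_diag aQ)); apply: csum_unique.
have := @cvg_series_scale _ mu _ _ (@pairing_cvg G f wG).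
have -> // : (fun n => mu * (G n * n`!%:R * taylor_coef f n)) =
  (fun m => \sum_(n < m.+1) a n (m - n)%N).
apply/funext => m; rewrite 2!mulrA -HG -mulrA big_distrl/=; apply: eq_bigr => n _.
have nm : (n <= m)%N by rewrite -ltnS.
rewrite /a iter_deriv_coef addnC subnK// -/c.
have -> : (m`!%:R : C) = n`!%:R * (m ^_ (m - n))%:R.
  by rewrite -natrM; congr (_%:R); have := ffact_fact (leq_subr n m); rewrite subKn// mulnC.
by ring.
Qed.

End Entire.

(** * Solving the eigenvalue equation *)
Section Eigen.
Variable R : realType.
Local Notation C := (Cplx R).
Implicit Types (z w : C) (f g phi : entire_fun R) (c d p F G : nat -> C) (r P : R).

Lemma strong_rec_exists (T : Type) (x0 : T) (step : nat -> (nat -> T) -> T) :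
  (forall m u v, (forall n, (n < m)%N -> u n = v n) -> step m u = step m v) ->
  exists F : nat -> T, forall m, F m = step m F.
Proof.
move=> stepE.
pose Fs := fix Fs m := if m is m'.+1 then rcons (Fs m') (step m' (nth x0 (Fs m'))) else [::].
have sz m : size (Fs m) = m by elim: m => [//|m IH]; rewrite /= size_rcons IH.
have nthE m k : (k < m)%N -> nth x0 (Fs m) k = nth x0 (Fs k.+1) k.
  elim: m => [//|m IH]; rewrite ltnS leq_eqVlt => /predU1P[->//|km].
  by rewrite /= nth_rcons sz km IH//= nth_rcons sz ltnn eqxx.
exists (fun m => nth x0 (Fs m.+1) m) => m.
rewrite /= nth_rcons sz ltnn eqxx; apply: stepE => n nm.
by rewrite nthE//= nth_rcons sz ltnn eqxx.
Qed.

Lemma geom_le1 (l : R) m : 0 <= l -> l < 1 -> \sum_(i < m) l ^+ i <= (1 - l)^-1.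
Proof.
move=> l0 l1; have d0 : 0 < 1 - l by lra.
rewrite -(ler_pM2l d0) mulfV ?lt0r_neq0//.
have := subrX1 l m => h.
have -> : (1 - l) * (\sum_(i < m) l ^+ i) = 1 - l ^+ m.
  by rewrite -[RHS]opprB h; ring.
by rewrite gerBl exprn_ge0.
Qed.

(** The sum is (B + l M)^(m+1) - (l M)^(m+1); factoring the difference of powers
    leaves B times a sum dominated by M^m (1 + l + l^2 + ...). *)
Lemma binom_diff (B l M : R) m : 0 <= B -> 0 <= l -> l < 1 -> 0 <= M -> B + l * M <= M ->
  \sum_(n < m.+1) 'C(m.+1, n)%:R * (l * M) ^+ n * B ^+ (m.+1 - n) <= B / (1 - l) * M ^+ m.
Proof.
move=> B0 l0 l1 M0 BM; have x0 : 0 <= l * M by rewrite mulr_ge0.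
have -> : \sum_(n < m.+1) 'C(m.+1, n)%:R * (l * M) ^+ n * B ^+ (m.+1 - n) =
    (B + l * M) ^+ m.+1 - (l * M) ^+ m.+1.
  rewrite exprDn [in RHS]big_ord_recr/= subnn expr0 binn mul1r mulr1n addrK.
  by apply: eq_bigr => n _; rewrite -mulr_natl; ring.
rewrite subrXX/= addrK -mulrA ler_wpM2l//.
apply: (@le_trans _ _ (\sum_(i < m.+1) M ^+ m * l ^+ i)).
  apply: ler_sum => i _; have im : (i <= m)%N by rewrite -ltnS.
  have -> : M ^+ m * l ^+ i = M ^+ (m - i) * (l * M) ^+ i.
    by rewrite exprMn mulrCA -exprD subnK// mulrC.
  by rewrite ler_wpM2r ?exprn_ge0// lerXn2r ?nnegrE ?addr_ge0.
by rewrite -big_distrr/= mulrC ler_wpM2r ?exprn_ge0// geom_le1.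
Qed.

(** F is the Taylor sequence of prod_k phi(lambda^k a) / phi(0). It is built
    from the equation: isolating n = m on the left gives
    p_0 (1 - lambda^m) F_m = sum_(n < m) F_n lambda^n p_(m-n), which determines
    F_m since |lambda| < 1. The bound |F_m| m! <= M^m follows by induction on m
    for M large, through [binom_diff]. *)
Lemma eigenweight_exists p (lambda : C) : p 0%N != 0 -> nrm lambda < 1 -> coef_exp p ->
  exists F, [/\ F 0%N = 1, weight F &
    forall m, \sum_(n < m.+1) F n * lambda ^+ n * p (m - n)%N = p 0%N * F m].
Proof.
move=> p0 l1 [A [B [A0 B0 pB]]].
have [m u v uv|F FE] := @strong_rec_exists C 0 (fun m F => if m is 0%N then 1 else
  (p 0%N * (1 - lambda ^+ m))^-1 * \sum_(n < m) F n * lambda ^+ n * p (m - n)%N).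
  case: m uv => [//|m] uv; congr (_ * _); apply: eq_bigr => n _; rewrite uv//.
set l := nrm lambda in l1 *.
have l0 : 0 <= l := nrm_ge0 _.
have lm m : 1 - l <= nrm (1 - lambda ^+ m.+1).
  have := nrmD (1 - lambda ^+ m.+1) (lambda ^+ m.+1); rewrite subrK nrm1 nrmX -/l.
  have : l ^+ m.+1 <= l by rewrite exprS ler_piMr// exprn_ile1// ltW.
  by lra.
have lm0 m : 1 - lambda ^+ m.+1 != 0.
  by rewrite -nrm_gt0; have := lm m; lra.
exists F; split; first by rewrite FE.
  have np0 : 0 < nrm (p 0%N) by rewrite nrm_gt0.
  have d0 : 0 < 1 - l by lra.
  (* D B / (1 - l) <= M closes the induction, B <= M (1 - l) feeds binom_diff *)
  pose D := A / (nrm (p 0%N) * (1 - l)).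
  have D0 : 0 <= D by rewrite divr_ge0// mulr_ge0// ltW.
  pose M := (D + 1) * B / (1 - l).
  have M0 : 0 < M by rewrite divr_gt0// mulr_gt0//; lra.
  have MB : B <= M * (1 - l) by rewrite /M divfK ?lt0r_neq0//; nra.
  have MD : D * (B / (1 - l)) <= M by rewrite /M mulrA ler_pM2r ?invr_gt0//; nra.
  exists 1, M; split => // m; rewrite mul1r.
  elim/ltn_ind: m => m IH; case: m IH => [|m] IH.
    by rewrite FE nrm1 fact0 mul1r expr0.
  rewrite FE nrmM nrmV nrmM.
  have kf k : (k`!%:R : R) != 0 by rewrite pnatr_eq0 -lt0n fact_gt0.
  apply: (@le_trans _ _ ((nrm (p 0%N) * (1 - l))^-1 * (\sum_(n < m.+1)
     (M ^+ n / n`!%:R) * l ^+ n * (A * B ^+ (m.+1 - n) / (m.+1 - n)`!%:R)) * (m.+1)`!%:R)).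
    rewrite ler_wpM2r//; apply: ler_pM; rewrite ?invr_ge0 ?mulr_ge0 ?nrm_ge0//.
      rewrite lef_pV2 ?posrE ?mulr_gt0//; first by rewrite ler_wpM2l ?lm ?nrm_ge0.
      by rewrite nrm_gt0.
    apply: le_trans (nrm_sum _ _ _) _; apply: ler_sum => n _.
    rewrite !nrmM nrmX; apply: ler_pM; rewrite ?mulr_ge0 ?nrm_ge0 ?exprn_ge0//.
    apply: ler_pM; rewrite ?nrm_ge0 ?exprn_ge0//.
    by rewrite ler_pdivlMr ?ltr0n ?fact_gt0// IH.
  have -> : (nrm (p 0%N) * (1 - l))^-1 * (\sum_(n < m.+1)
     (M ^+ n / n`!%:R) * l ^+ n * (A * B ^+ (m.+1 - n) / (m.+1 - n)`!%:R)) * (m.+1)`!%:R =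
     D * (\sum_(n < m.+1) 'C(m.+1, n)%:R * (l * M) ^+ n * B ^+ (m.+1 - n)).
    rewrite /D -mulrA [RHS]mulrAC [RHS]mulrC; congr (_ * _).
    rewrite big_distrl big_distrr/=.
    apply: eq_bigr => n _.
    have nm : (n <= m.+1)%N by apply: ltnW.
    rewrite -(bin_fact nm) !natrM [(l * M) ^+ n]exprMn; field.
    by rewrite !kf.
  have BM : B + l * M <= M by lra.
  have := binom_diff m (ltW B0) l0 l1 (ltW M0) BM => h.
  apply: le_trans (ler_wpM2l D0 h) _; rewrite mulrA exprS.
  by rewrite ler_wpM2r ?exprn_ge0// ltW.
case=> [|m]; first by rewrite big_ord_recr big_ord0/= add0r subnn FE expr0; ring.
rewrite big_ord_recr/= subnn.
have -> : \sum_(n < m.+1) F n * lambda ^+ n * p (m.+1 - n)%N =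
    p 0%N * (1 - lambda ^+ m.+1) * F m.+1.
  by rewrite [F m.+1]FE mulVKf// mulf_neq0.
by ring.
Qed.

(** Multiplication of the generating function by its variable. *)
Definition shift_weight (F : nat -> C) : nat -> C := fun n => if n is n'.+1 then F n' else 0.

Lemma weight_shift F : weight F -> weight (shift_weight F).
Proof.
move=> [K [M [K0 M0 H]]]; exists (K / M), (2 * M); split; [by rewrite divr_ge0// ltW|lra|].
case=> [|n] /=; first by rewrite nrm0 mul0r expr0 mulr1 divr_ge0// ltW.
rewrite factS mulnC natrM mulrA.
apply: (@le_trans _ _ (K * M ^+ n * 2 ^+ n.+1)).
  apply: ler_pM; rewrite ?mulr_ge0 ?nrm_ge0//.
  by rewrite -natrX ler_nat ltnW// ltn_expl.
rewrite exprMn exprS [M ^+ n.+1]exprS le_eqVlt; apply/orP; left; apply/eqP; field.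
by rewrite lt0r_neq0.
Qed.

Lemma eigenweight_shift F p (lambda mu : C) :
  (forall m, \sum_(n < m.+1) F n * lambda ^+ n * p (m - n)%N = mu * F m) ->
  forall m, \sum_(n < m.+1) shift_weight F n * lambda ^+ n * p (m - n)%N =
    (lambda * mu) * shift_weight F m.
Proof.
move=> H m; rewrite big_ord_recl/= !mul0r add0r.
case: m => [|m]; first by rewrite big_ord0 /= mulr0.
rewrite /= -mulrA -H big_distrr/=; apply: eq_bigr => n _.
by rewrite /bump/= add1n subSS exprS; ring.
Qed.

(** * Continuity of the functionals and conclusion *)
Definition affine_coef (a b : C) : nat -> C :=
  fun n => if n is n'.+1 then (if n' is _.+1 then 0 else b) else a.

Lemma finite_series (u : nat -> C) : (forall n, u n.+2 = 0) -> series u @ \oo --> u 0%N + u 1%N.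
Proof.
move=> u0; apply/cvg_series_shift/cvg_series_shift.
have -> : (fun n => u n.+2) = (fun _ => 0) by apply/funext.
have -> : u 0%N + u 1%N - u 0%N - u 1%N = 0 by ring.
exact: cvg_series0.
Qed.

Lemma pseries_affine (a b : C) : pseries (affine_coef a b) (fun z => a + b * z).
Proof.
split=> [r r0|z].
  exists (nrm a + nrm b * r) => -[|[|n]] /=.
  - by rewrite expr0 divr1 lerDl mulr_ge0 ?nrm_ge0// ltW.
  - by rewrite expr1 ler_pdivlMr// lerDr nrm_ge0.
  - by rewrite nrm0 divr_ge0 ?exprn_ge0 ?addr_ge0 ?mulr_ge0 ?nrm_ge0 ?(ltW r0).
have := @finite_series (fun n => affine_coef a b n * z ^+ n) _.
by rewrite /= expr0 expr1 mulr1; apply => n; rewrite mul0r.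
Qed.

(** Affine functions suffice to separate the two eigenfunctionals. *)
Lemma pairing_affine (a b : C) : exists f : entire_fun R,
  forall G, pairing G f = G 0%N * a + G 1%N * b.
Proof.
exists (Sub (fun z => a + b * z) (pseries_entire (pseries_affine a b)) : entire_fun R) => G.
rewrite /pairing (@pseries_taylor_coef _ (affine_coef a b)).
  2: by rewrite SubK; exact: pseries_affine.
apply: csum_unique.
have := @finite_series (fun n => G n * n`!%:R * affine_coef a b n) _.
by rewrite /= !mulr1; apply => n; rewrite mulr0.
Qed.

Lemma compact_line (l : R -> C) r : continuous l -> compact (l @` `[(- r), r]).
Proof.
by move=> cl; apply: continuous_compact; [exact: continuous_subspaceT|exact: segment_compact].
Qed.

Lemma edge_compact r : exists K : set C, compact K /\
  forall z, on_edge (- r) r (- r) r z -> K z.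
Proof.
exists (((fun x => cpoint x (- r)) @` `[(- r), r] `|` (fun x => cpoint x r) @` `[(- r), r]) `|`
  ((fun y => cpoint (- r) y) @` `[(- r), r] `|` (fun y => cpoint r y) @` `[(- r), r])); split.
  apply: compactU; apply: compactU.
  - exact: compact_line (@hline_continuous _ _).
  - exact: compact_line (@hline_continuous _ _).
  - exact: compact_line (@vline_continuous _ _).
  - exact: compact_line (@vline_continuous _ _).
move=> z [[h1 h2] h3]; case: h3 => [E|[E|[E|E]]].
- by right; left; exists (cim z); rewrite /= ?in_itv//= -E cpoint_eta.
- by right; right; exists (cim z); rewrite /= ?in_itv//= -E cpoint_eta.
- by left; left; exists (cre z); rewrite /= ?in_itv//= -E cpoint_eta.
- by left; right; exists (cre z); rewrite /= ?in_itv//= -E cpoint_eta.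
Qed.

(** The sides of a square form a compact set, and at a continuous function the
    compact-open neighbourhoods are those of uniform convergence on compacts. *)
Lemma near_edge f r (e : R) : 0 < e -> \forall g \near f,
  forall z, on_edge (- r) r (- r) r z -> nrm (\val g z - \val f z) < e.
Proof.
move=> e0; have [K [cK EK]] := edge_compact r.
have cf : continuous (\val f : C -> C) by move=> z; exact/holo_continuous/entire_holo.
have FF : Filter (nbhs (\val f : {compact-open, C -> C})) by exact: nbhs_filter.
have h : {family compact, nbhs (\val f : {compact-open, C -> C}) --> (\val f : C -> C)}.
  apply/(@compact_open_fam_compactP C C _ _ cf FF); exact: cvg_id.
pose E := [set xy : C * C | ball xy.1 (ofR e) xy.2].
have eE : entourage E by rewrite -entourage_ballE; exists (ofR e) => //=; rewrite -ofR0 ofR_lt.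
have := h _ (@fam_nbhs C C compact K E (\val f) eE cK).
move=> H.
have H2 := @initial_continuous _ _ (\val : entire_fun R -> {compact-open, C -> C}) f _ H.
apply: (@filterS _ _ (@nbhs_filter (entire_fun R) f) _ _ _ H2) => g gE z /EK /gE.
by rewrite /E/= -ball_normE /ball_/= nrmE ofR_lt nrmB.
Qed.

Lemma pairing_near G f (e : R) : weight G -> 0 < e ->
  \forall g \near f, nrm (pairing G g - pairing G f) < e.
Proof.
move=> wG e0; have [r [K [r0 K0 H]]] := pairing_bound wG.
have K1 : 0 < K + 1 by lra.
have := @near_edge f r (e / (K + 1)) (divr_gt0 e0 K1); apply: filterS => g hg.
have -> : pairing G g - pairing G f = pairing G (-1 *: f + g) by rewrite pairing_lin//; ring.
apply: (@le_lt_trans _ _ (K * (e / (K + 1)))).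
  apply: H => z /hg /ltW; apply: le_trans.
  have -> // : \val (-1 *: f + g) z = \val g z - \val f z.
  have -> : \val (-1 *: f + g) z = -1 * \val f z + \val g z by [].
  by rewrite mulN1r addrC.
by rewrite mulrA ltr_pdivrMr//; nra.
Qed.

Lemma pairing0 G : weight G -> pairing G 0 = 0.
Proof.
move=> wG; have := pairing_lin 1 0 0 wG; rewrite scale1r addr0 mul1r => h.
by rewrite -[LHS](addrK (pairing G 0)) -h subrr.
Qed.

Lemma pairing_scale G k f : weight G -> pairing G (k *: f) = k * pairing G f.
Proof. by move=> wG; have := pairing_lin k f 0 wG; rewrite addr0 pairing0// addr0. Qed.

Lemma pairing_orbit G (T : entire_fun R -> entire_fun R) (mu : C) f n : weight G ->
  (forall f, pairing G (T f) = mu * pairing G f) ->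
  pairing G (iter n T f) = mu ^+ n * pairing G f.
Proof.
move=> wG TG; elim: n => [|n IH]; first by rewrite expr0 mul1r.
by rewrite iterS TG IH exprS mulrA.
Qed.

(** On the projective orbit of f the two functionals are proportional up to
    powers of lambda, which bounds [pairing G] by a multiple of [pairing F]
    when [pairing F f] is nonzero. Density carries the bound over to g0, where
    it fails; so [pairing F] vanishes on the orbit, and by density at g1. *)
Lemma not_supercyclic (T : entire_fun R -> entire_fun R) F G (mu lambda : C) :
  weight F -> weight G -> nrm lambda <= 1 ->
  (forall f, pairing F (T f) = mu * pairing F f) ->
  (forall f, pairing G (T f) = (lambda * mu) * pairing G f) ->
  (exists g, pairing F g = 0 /\ pairing G g != 0) -> (exists g, pairing F g != 0) ->
  ~ supercyclic T.
Proof.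
move=> wF wG l1 TF TG [g0 [Fg0 Gg0]] [g1 Fg1] [f df].
have approx g (e : R) : 0 < e -> exists k n,
    nrm (pairing F (k *: iter n T f) - pairing F g) < e /\
    nrm (pairing G (k *: iter n T f) - pairing G g) < e.
  move=> e0.
  pose N := [set h | nrm (pairing F h - pairing F g) < e /\
    nrm (pairing G h - pairing G g) < e].
  have Ng : nbhs g N by apply: filterI; exact: pairing_near.
  have ne : N^° !=set0 by exists g; exact: Ng.
  have [x [/interior_subset[/= x1 x2] [k _ [n _ xE]]]] := df _ ne (@open_interior _ N).
  by exists k, n; rewrite xE.
have oF k n : pairing F (k *: iter n T f) = k * mu ^+ n * pairing F f.
  by rewrite pairing_scale// (pairing_orbit _ _ wF TF) mulrA.
have oG k n : pairing G (k *: iter n T f) = k * mu ^+ n * lambda ^+ n * pairing G f.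
  by rewrite pairing_scale// (pairing_orbit _ _ wG TG) exprMn; ring.
have Ff : pairing F f = 0.
  apply/eqP; rewrite -nrm_eq0 -[_ == 0]negbK; apply/negP => n0.
  have {}n0 : 0 < nrm (pairing F f) by rewrite lt_neqAle eq_sym n0 nrm_ge0.
  have G0 : 0 < nrm (pairing G g0) by rewrite nrm_gt0.
  have b0 := nrm_ge0 (pairing G f).
  set a := nrm (pairing F f) in n0; set b := nrm (pairing G f) in b0.
  set x := nrm (pairing G g0) in G0.
  have ab0 : 0 < a + b by lra.
  (* at an orbit point e-close to g0 the inequality gives x a < e (a + b) *)
  have e0 : 0 < x * a / (2 * (a + b)) by rewrite divr_gt0 ?mulr_gt0.
  have [k [n []]] := approx g0 _ e0.
  set e := _ / _ in e0 *.
  have eE : e * (a + b) = x * a / 2 by rewrite /e; field; rewrite lt0r_neq0.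
  rewrite Fg0 subr0 oF oG => h1 h2.
  have h3 := nrmD (pairing G g0 - k * mu ^+ n * lambda ^+ n * pairing G f)
    (k * mu ^+ n * lambda ^+ n * pairing G f).
  rewrite subrK nrmB -/x in h3.
  rewrite !nrmM -/a in h1; rewrite nrmM -/b (nrmM (k * _)) !nrmM (nrmX lambda) in h3.
  have l1n : nrm lambda ^+ n <= 1 by rewrite exprn_ile1// nrm_ge0.
  have ln0 : 0 <= nrm lambda ^+ n by rewrite exprn_ge0// nrm_ge0.
  have q0 : 0 <= nrm k * nrm (mu ^+ n) by rewrite mulr_ge0 ?nrm_ge0.
  move: h1 h2 h3 l1n ln0 q0; set q := nrm k * _; set t := nrm lambda ^+ n.
  move=> h1 h2 h3 l1n ln0 q0.
  have h4 : x < e + q * b.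
    have : q * t * b <= q * b by rewrite ler_wpM2r// ler_piMr.
    by lra.
  have : x * a < e * a + e * b.
    have s1 : x * a < (e + q * b) * a by rewrite ltr_pM2r.
    have s2 : q * a * b <= e * b by rewrite ler_wpM2r// ltW.
    by lra.
  rewrite -mulrDr eE; have : 0 < x * a by rewrite mulr_gt0.
  lra.
have F1 : 0 < nrm (pairing F g1) by rewrite nrm_gt0.
have [k [n [+ _]]] := approx g1 _ F1.
by rewrite oF Ff mulr0 sub0r nrmN ltxx.
Qed.

End Eigen.

Theorem theorem4p2 (R : realType) (lambda : Cplx R) (phi : entire_fun R)
    (hlambda : `|lambda| < 1)
    (hphi : exponential_type phi)
    (hphi0 : \val phi 0 != 0) :
  ~ supercyclic (dilation lambda \o diff_op phi).
Proof.
have l1 : nrm lambda < 1 by move: hlambda; rewrite nrmE -ofR1 ofR_lt.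
have p0 : taylor_coef phi 0 != 0 by rewrite /taylor_coef fact0 invr1 mulr1.
have [F [F0 wF HF]] := eigenweight_exists p0 l1 (exponential_coef hphi).
have wG := weight_shift wF.
apply: (not_supercyclic (F := F) (G := shift_weight F)
  (mu := taylor_coef phi 0) (lambda := lambda)) => //.
- exact: ltW.
- by move=> f; apply: pairing_eigen => //; exact: ltW.
- by move=> f; apply: pairing_eigen => //; [exact: ltW|exact: eigenweight_shift].
- have [g hg] := pairing_affine (- F 1%N) 1; exists g; rewrite !hg /= F0.
  by split; [ring|rewrite mul0r add0r mulr1 oner_neq0].
- have [g hg] := pairing_affine (1 : Cplx R) 0; exists g; rewrite hg F0.
  by rewrite mulr0 addr0 mulr1 oner_neq0.
Qed.
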